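(* Let $R$ be a proper subring of $\mathbb{Q}$, let $\Phi$ be a non-empty set of finite-rank-free-by-1 $R$-modules, and let $\kappa>|\Phi|$ be an infinite regular cardinal with $\kappa^{\aleph_0}=\kappa$. Then there exists a torsion-free, $\Phi$-complete, $\Phi$-represented $R$-module $G$ of rank $\kappa$. Moreover, if every module in $\Phi$ has rank at least $n+1$ (for a natural number $n$), then every $R$-submodule of $G$ of rank $\le n$ is free.
   Context: Let $R\subseteq\mathbb{Q}$ be a subring and $n\le\omega$. Let $B$ be the free $R$-module with basis $\{x_i:i<n\}\cup\{y_m:m\in\omega\}$, let $p_m\in R\setminus\{0\}$ and $k_{im}\in R$ with, for each $m$, $k_{im}=0$ for all but finitely many $i$, and let $N$ be the submodule generated by $y_{m+1}p_m-y_m-\sum_{i<n}x_ik_{im}$ $(m\in\omega)$. An $R$-module $G'$ is $n$-free-by-1 if $G'\cong B/N$ for such data, $G'$ is not free, and, if $n$ is finite, every $R$-submodule of $G'$ of rank $\le n$ is free; it is finite-rank-free-by-1 if it is $n$-free-by-1 for some finite $n$. For a set $\Phi$ of such modules: an $R$-module $L$ is $\Phi$-complete if $\mathrm{Ext}(G',L)=0$ for all $G'\in\Phi$; an $R$-module $G$ is $\Phi$-represented if $G=\bigcup_{\alpha<\lambda}G_\alpha$ for an ascending continuous chain of $R$-submodules with $G_0=0$ and each $G_{\alpha+1}/G_\alpha$ isomorphic to a member of $\Phi$ or to a free $R$-module. *)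

(* Defs.v *)
(* R-modules over a subring R of Q are modelled as
   lmodType R, where R comes with an injective ring morphism into rat. *)
From HB Require Import structures.
From mathcomp Require Import all_boot all_order all_algebra.
Set Implicit Arguments. Unset Strict Implicit. Unset Printing Implicit Defensive.
Import GRing.Theory.
Local Open Scope ring_scope.

Definition card_le (A B : Type) : Prop := exists f : A -> B, injective f.
Definition card_lt (A B : Type) : Prop := card_le A B /\ ~ card_le B A.
Definition card_eq (A B : Type) : Prop := exists f : A -> B, bijective f.

Definition infinite_regular (K : Type) : Prop :=
  card_le nat K /\
  forall (J : Type) (U : J -> K -> Prop),
    card_lt J K -> (forall j, card_lt {x : K | U j x} K) ->
    exists x : K, forall j, ~ U j x.

Section Modules.
Variable R : comNzRingType.

Definition is_lin (M N : lmodType R) (f : M -> N) : Prop :=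
  forall (a : R) (x y : M), f (a *: x + y) = a *: f x + f y.

Definition submodule (M : lmodType R) (S : M -> Prop) : Prop :=
  S 0 /\ forall (a : R) (x y : M), S x -> S y -> S (a *: x + y).

Definition independent (M : lmodType R) (B : M -> Prop) : Prop :=
  forall (s : seq M) (c : nat -> R), uniq s ->
    (forall j, (j < size s)%N -> B (nth 0 s j)) ->
    \sum_(j < size s) c j *: nth 0 s j = 0 ->
    forall j, (j < size s)%N -> c j = 0.

Definition span_in (M : lmodType R) (B : M -> Prop) (x : M) : Prop :=
  exists (s : seq M) (c : nat -> R),
    (forall j, (j < size s)%N -> B (nth 0 s j)) /\
    x = \sum_(j < size s) c j *: nth 0 s j.

Definition free_sub (M : lmodType R) (S : M -> Prop) : Prop :=
  exists B : M -> Prop, (forall x, B x -> S x) /\ independent B /\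
    forall x, S x -> span_in B x.

Definition free (M : lmodType R) : Prop := free_sub (fun _ : M => True).

Definition torsion_free (M : lmodType R) : Prop :=
  forall (r : R) (x : M), r *: x = 0 -> r = 0 \/ x = 0.

Definition rank_at_most (M : lmodType R) (S : M -> Prop) (n : nat) : Prop :=
  forall s : seq M, uniq s -> (forall x, x \in s -> S x) ->
    independent (fun x => x \in s) -> (size s <= n)%N.

Definition rank_at_least (M : lmodType R) (n : nat) : Prop :=
  exists s : seq M, [/\ uniq s, size s = n & independent (fun x => x \in s)].

Definition rank_is (M : lmodType R) (K : Type) : Prop :=
  exists f : K -> M, [/\ injective f,
    independent (fun x => exists k, f k = x) &
    forall B : M -> Prop, independent B ->
      (forall k, B (f k)) -> forall x, B x -> exists k, f k = x].

(* n : option nat, with None standing for omega *)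
Definition inN (n : option nat) (i : nat) : bool :=
  if n is Some n' then (i < n')%N else true.

(* M ~= B/N for data (p, k): unfolded as the existence of images
   x_i, y_m in M of the basis of B such that the induced map B -> M is
   surjective with kernel exactly N. *)
Definition presented_by (n : option nat) (M : lmodType R) : Prop :=
  exists (x y : nat -> M) (p : nat -> R) (k : nat -> nat -> R) (bnd : nat -> nat),
  [/\ (forall m, p m != 0),
      (forall i m, ~~ inN n i -> k i m = 0),
      (forall i m, (bnd m <= i)%N -> k i m = 0) &
  [/\ (* the images satisfy the relations (the generators of N map to 0) *)
      (forall m, p m *: y m.+1 - y m - \sum_(i < bnd m) k i m *: x i = 0),
      (forall g : M, exists (N : nat) (a b : nat -> R),
         g = \sum_(i < N | inN n i) a i *: x i + \sum_(m < N) b m *: y m) &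
      (* kernel is contained in N *)
      (forall (N : nat) (a b : nat -> R),
         \sum_(i < N | inN n i) a i *: x i + \sum_(m < N) b m *: y m = 0 ->
         exists (L : nat) (c : nat -> R),
         [/\ (forall m, (L <= m)%N -> c m = 0),
             (forall i, inN n i ->
                (if (i < N)%N then a i else 0) = - \sum_(m < L) c m * k i m) &
             (forall m,
                (if (m < N)%N then b m else 0) =
                (if m is m'.+1 then c m' * p m' else 0) - c m)])]].

Definition free_by_1 (n : option nat) (M : lmodType R) : Prop :=
  [/\ presented_by n M, ~ free M &
      forall n' : nat, n = Some n' ->
        forall S : M -> Prop, submodule S -> rank_at_most S n' -> free_sub S].

Definition finite_rank_free_by_1 (M : lmodType R) : Prop :=
  exists n : nat, free_by_1 (Some n) M.

Definition Ext_zero (Gp L : lmodType R) : Prop :=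
  forall (E : lmodType R) (f : L -> E) (g : E -> Gp),
    is_lin f -> is_lin g -> injective f -> (forall z, exists e, g e = z) ->
    (forall e, g e = 0 <-> exists l, f l = e) ->
    exists s : Gp -> E, is_lin s /\ forall z, g (s z) = z.

Definition Phi_complete (I : Type) (Phi : I -> lmodType R) (L : lmodType R) : Prop :=
  forall i, Ext_zero (Phi i) L.

Definition quot_iso (M : lmodType R) (Bsub Asub : M -> Prop) (N : lmodType R) : Prop :=
  exists phi : M -> N,
    [/\ (forall (a : R) (x y : M), Bsub x -> Bsub y ->
           phi (a *: x + y) = a *: phi x + phi y),
        (forall z, exists x, Bsub x /\ phi x = z) &
        (forall x, Bsub x -> (phi x = 0 <-> Asub x))].

(* M is the union of an ascending continuous chain (G_alpha)_{alpha < lambda},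
   lambda an ordinal (a well-ordered type), G_0 = 0, and each
   G_{alpha+1}/G_alpha isomorphic to a member of Phi or to a free module. *)
Definition Phi_represented (I : Type) (Phi : I -> lmodType R) (M : lmodType R) : Prop :=
  exists (L : Type) (lt : L -> L -> Prop) (Gc : L -> M -> Prop),
  [/\ (forall a b c, lt a b -> lt b c -> lt a c),
      (forall a, ~ lt a a),
      (forall a b, a = b \/ lt a b \/ lt b a) &
      well_founded lt] /\
  [/\ (forall a, submodule (Gc a)),
      (forall a b, lt a b -> forall x, Gc a x -> Gc b x) &
      (forall a, (forall b, ~ lt b a) -> forall x, Gc a x <-> x = 0)] /\
  (forall a, (exists b, lt b a) ->
     (~ exists b, lt b a /\ forall c, ~ (lt b c /\ lt c a)) ->
     forall x, Gc a x <-> exists b, lt b a /\ Gc b x) /\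
  (forall x, exists a, Gc a x) /\
  (forall a b, lt a b -> (forall c, ~ (lt a c /\ lt c b)) ->
     (exists i, quot_iso (Gc b) (Gc a) (Phi i)) \/
     (exists F : lmodType R, free F /\ quot_iso (Gc b) (Gc a) F)).

End Modules.

(* Main.v *)
From HB Require Import structures.
From mathcomp Require Import all_boot all_order all_algebra.
From mathcomp Require Import boolp classical_sets functions cardinality wochoice.
Require Import Defs.
Import GRing.Theory.
Set Implicit Arguments.
Unset Strict Implicit.
Unset Printing Implicit Defensive.
Local Open Scope classical_set_scope.
Local Open Scope ring_scope.

(** The relations of a module in Phi are encoded by polynomials, the j-th
    generator being 'X^j. The module G is generated, inside a rational vector
    space, by copies of such generators attached to the nodes of a well-founded,
    countably branching tree: a node consists of an index i and a sequence of
    formal combinations of generators of its children, and its own generators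
    satisfy the relations of Phi i with these combinations as right-hand sides.
    Every sequence in G occurs as the right-hand side at some node, so every
    extension of Phi i by G splits. A node is determined by the labels along its
    finite paths, so there are at most kappa^omega = kappa nodes. A well-order
    extending the child relation filters G, and the coordinates at a node
    identify the corresponding quotient with Phi i. A submodule of finite rank is
    bounded by some node: its image in the quotient at that node is free, and so
    is, by induction, its part below the node. *)

(** * Submodules and independence *)

Lemma image_section (U W : Type) (u : U) (f : U -> W) (B : set U) :
  exists g : W -> U, forall z, (f @` B) z -> B (g z) /\ f (g z) = z.
Proof.
suff /choice[g gP] : forall z, exists x, (f @` B) z -> B x /\ f x = z.
  by exists g.
by move=> z; have [[x Bx <-]|nz] := pselect ((f @` B) z); [exists x|exists u].
Qed.

Section Submodules.
Variable R : comNzRingType.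
Implicit Types M N W : lmodType R.

Lemma is_lin_linear M N (f : M -> N) :
  is_lin f -> exists g : {linear M -> N}, f = g.
Proof.
move=> lf; pose mf := GRing.isLinear.Build R M N *:%R f lf.
by exists (HB.pack_for {linear M -> N} f mf).
Qed.

Section Closure.
Variables (M : lmodType R) (S : set M).
Hypothesis sS : submodule S.

Lemma submodule0 : S 0. Proof. by case: sS. Qed.

Lemma submoduleD x y : S x -> S y -> S (x + y).
Proof. by move=> Sx Sy; rewrite -[x]scale1r; apply: sS.2. Qed.

Lemma submoduleZ a x : S x -> S (a *: x).
Proof.
by move=> Sx; rewrite -[_ *: _]addr0; apply: sS.2 => //; exact: submodule0.
Qed.

Lemma submoduleN x : S x -> S (- x).
Proof. by move=> Sx; rewrite -scaleN1r; exact: submoduleZ. Qed.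

Lemma submoduleB x y : S x -> S y -> S (x - y).
Proof. by move=> Sx Sy; apply: submoduleD => //; exact: submoduleN. Qed.

Lemma submodule_sum J (r : seq J) (P : pred J) (F : J -> M) :
  (forall j, P j -> S (F j)) -> S (\sum_(j <- r | P j) F j).
Proof.
by move=> SF; apply: big_ind; [exact: submodule0|exact: submoduleD|].
Qed.

End Closure.

Lemma submodule_set0 M : submodule [set 0 : M].
Proof. by split=> // a x y -> ->; rewrite scaler0 addr0. Qed.

Lemma submodule_setI M (S T : set M) :
  submodule S -> submodule T -> submodule (S `&` T).
Proof.
by move=> [S0 SD] [T0 TD]; split=> // a x y [Sx Tx] [Sy Ty]; split; auto.
Qed.

Lemma submodule_preimage M N (f : {linear M -> N}) (S : set N) :
  submodule S -> submodule (f @^-1` S).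
Proof.
move=> [S0 SD]; split=> [|a x y Sx Sy] /=; first by rewrite linear0.
by rewrite linearP; exact: SD.
Qed.

Lemma submodule_image M N (f : {linear M -> N}) (S : set M) :
  submodule S -> submodule (f @` S).
Proof.
move=> [S0 SD]; split=> [|a _ _ [x Sx <-] [y Sy <-]].
  by exists 0; rewrite ?linear0.
by exists (a *: x + y); [exact: SD|rewrite linearP].
Qed.

Lemma span_inP M (B : set M) (x : M) :
  span_in B x <-> exists s : seq (R * M),
    (forall z, z \in s -> B z.2) /\ x = \sum_(z <- s) z.1 *: z.2.
Proof.
split=> [[s [c [sB ->]]]|[s [sB ->]]].
  exists [seq (c j, nth 0 s j) | j <- iota 0 (size s)]; split.
    move=> z /mapP[j]; rewrite mem_iota add0n => /andP[_ js] -> /=.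
    exact: sB.
  by rewrite big_map -[in RHS](subn0 (size s)) big_mkord.
exists [seq z.2 | z <- s], (fun j => (nth (0, 0) s j).1); split.
  move=> j; rewrite size_map => js; rewrite (nth_map (0, 0)) //.
  exact/sB/mem_nth.
rewrite (big_nth (0, 0)) big_mkord size_map; apply: eq_bigr => i _.
by rewrite (nth_map (0, 0)).
Qed.

Lemma span_in_submodule M (B : set M) : submodule (span_in B).
Proof.
split=> [|a x y /span_inP[s [sB ->]] /span_inP[t [tB ->]]].
  by apply/span_inP; exists [::]; rewrite big_nil.
apply/span_inP; exists ([seq (a * z.1, z.2) | z <- s] ++ t); split.
  by move=> z; rewrite mem_cat => /orP[/mapP[w /sB ws ->]|/tB].
rewrite big_cat big_map scaler_sumr; congr (_ + _).
by apply: eq_bigr => z _; rewrite scalerA.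
Qed.

Lemma sub_span_in M (B : set M) : B `<=` span_in B.
Proof.
move=> x Bx; apply/span_inP; exists [:: (1, x)]; rewrite big_seq1 scale1r.
by split=> // z; rewrite inE => /eqP ->.
Qed.

Lemma span_in_min M (B S : set M) :
  submodule S -> B `<=` S -> span_in B `<=` S.
Proof.
move=> sS BS _ /span_inP[s [sB ->]].
rewrite big_seq; apply: submodule_sum => // z zs.
by apply: submoduleZ => //; exact/BS/sB.
Qed.

Lemma span_inS M (B C : set M) : B `<=` C -> span_in B `<=` span_in C.
Proof.
move=> BC; apply: span_in_min => [|x /BC]; first exact: span_in_submodule.
exact: sub_span_in.
Qed.

Lemma span_in_uniq M (B : set M) x : span_in B x ->
  exists (s : seq M) (c : M -> R),
  [/\ uniq s, forall y, y \in s -> B y & x = \sum_(y <- s) c y *: y].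
Proof.
move=> /span_inP[s [sB ->]].
exists (undup [seq z.2 | z <- s]), (fun y => \sum_(z <- s | z.2 == y) z.1).
split=> [|y|]; first exact: undup_uniq.
  by rewrite mem_undup => /mapP[z zs ->]; exact: sB.
under [RHS]eq_bigr => y _ do rewrite scaler_suml big_mkcond.
rewrite exchange_big /=; apply: eq_big_seq => z zs.
rewrite (bigD1_seq z.2) ?undup_uniq ?mem_undup ?map_f //= eqxx big1 ?addr0 //.
by move=> y; rewrite eq_sym => /negPf ->.
Qed.

Lemma independentP M (B : set M) :
  independent B <-> (forall (s : seq M) (c : M -> R), uniq s ->
    (forall x, x \in s -> B x) -> \sum_(x <- s) c x *: x = 0 ->
    forall x, x \in s -> c x = 0).
Proof.
split=> [iB s c us sB sc0 x xs|iB s c us sB sc0 j js].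
  rewrite -(nth_index 0 xs).
  apply: (iB s (fun j => c (nth 0 s j))) => //; last by rewrite index_mem.
    by move=> j js; apply/sB/mem_nth.
  by rewrite (big_nth 0) big_mkord in sc0.
have := iB s (fun x => c (index x s)) us _ _ (nth 0 s j) (mem_nth 0 js).
rewrite index_uniq //; apply.
  by move=> x xs; rewrite -(nth_index 0 xs); apply: sB; rewrite index_mem.
rewrite (big_nth 0) big_mkord -[RHS]sc0; apply: eq_bigr => i _.
by rewrite index_uniq.
Qed.

Lemma independentS M (B C : set M) : B `<=` C -> independent C -> independent B.
Proof. by move=> BC iC s c us sB; apply: iC => // j /sB/BC. Qed.

Lemma independent_set0 M : independent (set0 : set M).
Proof. by move=> s c _ sB _ j /sB. Qed.

Lemma independent_image_sum_eq0 M N (f : {linear M -> N}) (B : set M)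
    (s : seq M) (c : M -> R) :
  set_inj B f -> independent (f @` B) -> uniq s -> (forall x, x \in s -> B x) ->
  \sum_(x <- s) c x *: f x = 0 -> forall x, x \in s -> c x = 0.
Proof.
move=> fI /independentP iB us sB sc0 x xs.
have fIs : {in s &, injective f}.
  by move=> y z /sB/mem_set By /sB/mem_set Bz; exact: fI.
have fK y : y \in s -> nth 0 s (index (f y) (map f s)) = y.
  exact: nth_index_map.
have := iB (map f s) (fun z => c (nth 0 s (index z (map f s)))).
rewrite -[in X in _ -> X](fK x xs); apply; last exact: map_f.
- by rewrite map_inj_in_uniq.
- by move=> _ /mapP[y /sB By ->]; exists y.
- by rewrite big_map -[RHS]sc0; apply: eq_big_seq => y ys; rewrite fK.
Qed.

Lemma independent_preimage M N (f : {linear M -> N}) (B : set M) :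
  set_inj B f -> independent (f @` B) -> independent B.
Proof.
move=> fI iB; apply/independentP => s c us sB sc0.
apply: (independent_image_sum_eq0 fI iB us sB).
rewrite -[RHS](linear0 f) -sc0 linear_sum.
by apply: eq_bigr => x _; rewrite linearZ.
Qed.

Lemma independent_image M N (f : {linear M -> N}) (B : set M) :
  injective f -> independent B -> independent (f @` B).
Proof.
move=> fI /independentP iB; apply/independentP => s c us sB sc0 z zs.
have [g gP] := image_section 0 f B.
have gB y : y \in s -> B (g y) by move=> /sB/gP[].
have fgK y : y \in s -> f (g y) = y by move=> /sB/gP[].
rewrite -(fgK z zs); apply: (iB (map g s) (c \o f)); last exact: map_f.
- by rewrite map_inj_in_uniq // => y y' /fgK fy /fgK fy' e; rewrite -fy e.
- by move=> _ /mapP[y /gB By ->].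
apply: fI; rewrite linear0 linear_sum big_map -[RHS]sc0.
by apply: eq_big_seq => y ys /=; rewrite linearZ fgK.
Qed.

Lemma independent_setU_ker M N (f : {linear M -> N}) (B D : set M) :
  B `<=` f @^-1` [set 0] -> independent B ->
  set_inj D f -> independent (f @` D) -> independent (B `|` D).
Proof.
move=> Bf /independentP iB fI iD; apply/independentP => s c us sBD sc0.
pose sB := [seq x <- s | `[< B x >]]; pose sD := [seq x <- s | ~~ `[< B x >]].
have sDP x : x \in sD -> D x.
  by rewrite mem_filter => /andP[/asboolPn nB /sBD[]].
have split_sum (F : M -> M) :
    \sum_(x <- s) F x = \sum_(x <- sB) F x + \sum_(x <- sD) F x.
  by rewrite !big_filter -(bigID (fun x => `[< B x >]) xpredT).
have cD x : x \in sD -> c x = 0.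
  apply: (independent_image_sum_eq0 fI iD) => //; first exact: filter_uniq.
  rewrite -[RHS](linear0 f) -sc0 split_sum linearD !linear_sum /=.
  rewrite big_seq [X in _ = X + _]big_seq [X in _ = X + _]big1 ?add0r.
    by rewrite -big_seq; apply: eq_bigr => y _; rewrite linearZ.
  move=> y; rewrite mem_filter => /andP[/asboolP/Bf fy _].
  by rewrite linearZ /= fy scaler0.
have cB x : x \in sB -> c x = 0.
  apply: iB => [||]; first exact: filter_uniq.
    by move=> y; rewrite mem_filter => /andP[/asboolP].
  move: sc0; rewrite split_sum [X in _ + X]big_seq [X in _ + X]big1 ?addr0 //.
  by move=> y /cD ->; rewrite scale0r.
move=> x xs; have [Bx|nBx] := boolP `[< B x >].
  by apply: cB; rewrite mem_filter Bx.
by apply: cD; rewrite mem_filter nBx.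
Qed.

Lemma free_sub_set0 M (S : set M) : S `<=` [set 0] -> free_sub S.
Proof.
move=> S0; exists set0; split=> //; split; first exact: independent_set0.
by move=> x /S0 ->; exact: submodule0 (span_in_submodule _).
Qed.

Lemma free_sub_extension M N (f : {linear M -> N}) (S : set M) :
  submodule S -> free_sub (S `&` f @^-1` [set 0]) -> free_sub (f @` S) ->
  free_sub S.
Proof.
move=> sS [B [BS [iB spB]]] [C [CS [iC spC]]].
have [g gP] := image_section 0 f S.
pose D := g @` C; have DS : D `<=` S by move=> _ [z /CS/gP[Sg _] <-].
have fD : f @` D = C.
  apply/seteqP; split=> [_ [_ [z Cz <-] <-]|z Cz].
    by have [_ ->] := gP z (CS z Cz).
  by exists (g z); [exists z|have [] := gP z (CS z Cz)].
have fI : set_inj D f.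
  move=> _ _ /set_mem[z Cz <-] /set_mem[w Cw <-].
  by have [_ ->] := gP z (CS z Cz); have [_ ->] := gP w (CS w Cw) => ->.
exists (B `|` D); split; first by move=> x [/BS[]|/DS].
split; first by apply: independent_setU_ker iB fI _; rewrite ?fD // => x /BS[].
move=> x Sx; have [y Dy fy] : (f @` span_in D) (f x).
  have : span_in C (f x) by apply: spC; exists x.
  apply: span_in_min; first exact/submodule_image/span_in_submodule.
  by rewrite -fD => _ [y /sub_span_in Dy <-]; exists y.
have Sy : S y by exact: (span_in_min sS DS).
rewrite -(subrK y x); apply: submoduleD; first exact: span_in_submodule.
  apply: (@span_inS _ B); first exact: subsetUl.
  by apply: spB; split; [exact: submoduleB|rewrite /= linearB fy subrr].
by apply: span_inS Dy; exact: subsetUr.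
Qed.

Lemma free_sub_preimage M N (f : {linear M -> N}) (S : set N) :
  injective f -> S `<=` range f -> free_sub (f @^-1` S) -> free_sub S.
Proof.
move=> fI Sf [B [BS [iB spB]]]; exists (f @` B).
split; [by move=> _ [x /BS Sx <-]|split; first exact: independent_image].
move=> z Sz; have [x _ fx] := Sf z Sz; rewrite -fx in Sz *.
have : (f @^-1` span_in (f @` B)) x; last by [].
apply: (span_in_min _ _ (spB x Sz)).
  exact/submodule_preimage/span_in_submodule.
by move=> y By; apply: sub_span_in; exists y.
Qed.

Lemma rank_at_mostS M (S T : set M) n :
  S `<=` T -> rank_at_most T n -> rank_at_most S n.
Proof. by move=> ST rT s us sS; apply: rT => // x /sS/ST. Qed.

Lemma rank_at_most_image M N (f : {linear M -> N}) (S : set M) n :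
  rank_at_most S n -> rank_at_most (f @` S) n.
Proof.
move=> rS s us sS iS; have [g gP] := image_section 0 f S.
have fgK z : z \in s -> f (g z) = z by move=> /sS/gP[].
rewrite -(size_map g s); apply: rS.
- by rewrite map_inj_in_uniq // => y z /fgK fy /fgK fz e; rewrite -fy e.
- by move=> _ /mapP[z /sS/gP[Sg _] ->].
apply: (@independent_preimage _ _ f).
  move=> _ _ /set_mem/mapP[y ys ->] /set_mem/mapP[z zs ->].
  by rewrite !fgK // => ->.
by apply: independentS iS => _ [_ /mapP[z zs ->] <-]; rewrite fgK.
Qed.

Lemma rank_at_most_preimage M N (f : {linear M -> N}) (S : set N) n :
  injective f -> rank_at_most S n -> rank_at_most (f @^-1` S) n.
Proof.
move=> fI rS s us sS iS; rewrite -(size_map f s); apply: rS.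
- by rewrite map_inj_uniq.
- by move=> _ /mapP[x /sS Sx ->].
by apply: independentS (independent_image fI iS) => _ /mapP[x xs ->]; exists x.
Qed.

Lemma linear_factor M N W (h : {linear W -> M}) (g : {linear W -> N}) :
  range h = setT -> (forall u, h u = 0 -> g u = 0) ->
  exists s : {linear M -> N}, forall u, s (h u) = g u.
Proof.
move=> hS hg; have [k kP] := image_section 0 h setT.
have hK x : h (k x) = x by have [] := kP x; rewrite ?hS.
have gE u v : h u = h v -> g u = g v.
  move=> huv; apply/eqP; rewrite -subr_eq0 -linearB; apply/eqP/hg.
  by rewrite linearB huv subrr.
have [s sE] : exists s : {linear M -> N}, g \o k = s.
  apply: is_lin_linear => a x y /=; rewrite -linearP; apply: gE.
  by rewrite linearP !hK.
by exists s => u; rewrite -sE /=; apply: gE; rewrite hK.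
Qed.

Lemma quot_iso_linear M N W (f : {linear M -> W}) (g : {linear N -> W})
    (S S' : set M) :
  injective g -> submodule S -> f @` S = range g ->
  S' = S `&` f @^-1` [set 0] ->
  quot_iso S S' N.
Proof.
move=> gI sS fS ->.
have /choice[h hP] : forall x, exists z, S x -> g z = f x.
  move=> x; have [Sx|nSx] := pselect (S x); last by exists 0.
  have [z _ gz] : range g (f x) by rewrite -fS; exists x.
  by exists z.
exists h; split.
- move=> a x y Sx Sy; apply: gI; rewrite linearP !hP ?linearP //.
  exact: sS.2.
- move=> z; have [x Sx fx] : (f @` S) (g z) by rewrite fS; exists z.
  by exists x; split=> //; apply: gI; rewrite hP.
- move=> x Sx; split=> [h0|[_ /= fx]]; last by apply: gI; rewrite hP // linear0.
  by split=> //=; rewrite -hP // h0 linear0.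
Qed.

End Submodules.

Section Purity.
Variable R : comNzRingType.
Hypothesis R_domain : GRing.integral_domain_axiom R.
Implicit Types M N : lmodType R.

Definition pure M (S : set M) : Prop :=
  forall (d : R) (x : M), d != 0 -> S (d *: x) -> S x.

Definition pure_closure M (S : set M) : set M :=
  [set x | exists2 d : R, d != 0 & S (d *: x)].

Lemma domain_mulf_neq0 (a b : R) : a != 0 -> b != 0 -> a * b != 0.
Proof.
move=> a0 b0; apply/eqP => /R_domain.
by rewrite (negPf a0) (negPf b0).
Qed.

Lemma sub_pure_closure M (S : set M) : S `<=` pure_closure S.
Proof. by move=> x Sx; exists 1; [exact: oner_neq0|rewrite scale1r]. Qed.

Lemma pure_closureS M (S T : set M) :
  S `<=` T -> pure_closure S `<=` pure_closure T.
Proof. by move=> ST x [d d0 Sx]; exists d => //; exact: ST. Qed.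

Lemma pure_closure_submodule M (S : set M) :
  submodule S -> submodule (pure_closure S).
Proof.
move=> sS; split=> [|a x y [d d0 Sx] [d' d'0 Sy]].
  by apply: sub_pure_closure; exact: submodule0.
exists (d * d'); first exact: domain_mulf_neq0.
have -> : (d * d') *: (a *: x + y) = (a * d') *: (d *: x) + d *: (d' *: y).
  by rewrite scalerDr !scalerA; congr (_ *: x + _); rewrite mulrC mulrA mulrAC.
by apply: submoduleD => //; exact: submoduleZ.
Qed.

Lemma pure_pure_closure M (S : set M) : pure (pure_closure S).
Proof.
move=> d x d0 [d' d'0]; rewrite scalerA => Sx.
by exists (d' * d) => //; exact: domain_mulf_neq0.
Qed.

Lemma pure_set0 M : torsion_free M -> pure [set 0 : M].
Proof. by move=> tM d x d0 /= /tM[/eqP|//]; rewrite (negPf d0). Qed.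

Lemma pure_preimage M N (f : {linear M -> N}) (S : set N) :
  pure S -> pure (f @^-1` S).
Proof. by move=> pS d x d0; rewrite /= linearZ; exact: pS. Qed.

Lemma independent_setU1 M (B : set M) x :
  independent B -> ~ pure_closure (span_in B) x -> independent (B `|` [set x]).
Proof.
move=> /independentP iB nBx; apply/independentP => s c us sB sc0.
have sBD y : y \in s -> y != x -> B y by move=> /sB[//|/= ->]; rewrite eqxx.
have cx : x \in s -> c x = 0.
  move=> xs; apply: contrapT => /eqP cx0; apply: nBx; exists (c x) => //.
  move: sc0; rewrite (bigD1_seq x) //= => /eqP; rewrite addr_eq0 => /eqP ->.
  have sp := span_in_submodule B; apply: (submoduleN sp).
  rewrite big_seq_cond; apply: (submodule_sum sp) => y /andP[ys yx].
  by apply: (submoduleZ sp); apply: sub_span_in; exact: sBD.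
move=> y ys; have [yx|yx] := eqVneq y x; first by rewrite yx cx // -yx.
apply: (iB [seq z <- s | z != x]); rewrite ?mem_filter ?yx ?filter_uniq //.
  by move=> z; rewrite mem_filter => /andP[zx zs]; exact: sBD.
rewrite big_filter big_mkcond -[RHS]sc0; apply: eq_big_seq => z zs.
by case: eqVneq zs => //= -> /cx ->; rewrite scale0r.
Qed.

Lemma independent_setD1 M (B : set M) x :
  independent B -> B x -> ~ pure_closure (span_in (B `\ x)) x.
Proof.
move=> /independentP iB Bx [d d0 /span_in_uniq[s [c [us sB dx]]]].
have xs : x \notin s by apply/negP => /sB[_ /(_ erefl)].
have := iB (x :: s) (fun y => if y == x then d else - c y).
move=> /(_ _ _ _ x (mem_head _ _)); rewrite eqxx => d_eq0; move: d0.
rewrite d_eq0 ?eqxx //=; first by rewrite xs us.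
  by move=> y; rewrite inE => /orP[/eqP -> //|/sB[]].
rewrite big_cons eqxx dx -big_split big_seq big1 //= => y ys.
by rewrite ifN ?scaleNr ?subrr //; apply: contraNneq xs => <-.
Qed.

Lemma rank_is_torsion M (K : Type) (f : K -> M) :
  injective f -> independent (range f) ->
  (forall x, pure_closure (span_in (range f)) x) -> rank_is M K.
Proof.
move=> fI iF Ff; exists f; split=> //.
  by apply: independentS iF => _ [k <-]; exists k.
move=> B iB Bf x Bx; apply: contrapT => nx.
apply: (independent_setD1 iB Bx); apply: pure_closureS (Ff x).
apply: span_inS => _ [k _ <-]; split=> // fx.
by apply: nx; exists k.
Qed.

Lemma rank_at_most_span M (S : set M) n : rank_at_most S n ->
  exists s : seq M, [set` s] `<=` S /\ S `<=` pure_closure (span_in [set` s]).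
Proof.
move=> rS; pose P m := `[< exists s : seq M, [/\ uniq s,
  [set` s] `<=` S, independent [set` s] & size s = m] >].
have exP : exists m, P m.
  exists 0%N; apply/asboolP; exists [::]; split=> //.
  by apply: independentS (@independent_set0 _ M) => x.
have Pn m : P m -> (m <= n)%N by move=> /asboolP[s [us sS iS <-]]; exact: rS.
case: (ex_maxnP exP Pn) => m /asboolP[s [us sS iS sm]] mmax.
exists s; split=> // x Sx; apply: contrapT => nx.
have : (m.+1 <= m)%N; last by rewrite ltnn.
apply: mmax; apply/asboolP; exists (x :: s); split; last by rewrite /= sm.
- rewrite /= us andbT; apply/negP => xs; apply: nx.
  by apply: sub_pure_closure; exact: sub_span_in.
- by move=> y /=; rewrite inE => /orP[/eqP ->|/sS].
apply: independentS (independent_setU1 iS nx) => y /=.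
by rewrite inE => /orP[/eqP ->|ys]; [right|left].
Qed.

End Purity.

(** * Modules presented by a relation system *)

Section LinearCombinations.
Variable R : comNzRingType.
Implicit Types M N : lmodType R.

Definition lcomb M (e : nat -> M) (u : {poly R}) : M :=
  \sum_(j < size u) u`_j *: e j.

Definition generating M (e : nat -> M) : Prop := range (lcomb e) = setT.

Lemma lcomb_widen M (e : nat -> M) (u : {poly R}) k :
  (size u <= k)%N -> lcomb e u = \sum_(j < k) u`_j *: e j.
Proof.
move=> uk.
rewrite /lcomb (big_ord_widen k (fun j => u`_j *: e j)) // big_mkcond.
by apply: eq_bigr => j _; case: ltnP => // /(nth_default 0) ->; rewrite scale0r.
Qed.

Fact lcomb_is_linear M (e : nat -> M) : linear (lcomb e).
Proof.
move=> a u v; pose k := maxn (size u) (size v).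
rewrite !(@lcomb_widen _ _ _ k) ?leq_maxl ?leq_maxr //; last first.
  apply: leq_trans (size_polyD _ _) _; rewrite geq_max leq_maxr andbT.
  by apply: leq_trans (size_scale_leq _ _) (leq_maxl _ _).
rewrite scaler_sumr -big_split; apply: eq_bigr => j _ /=.
by rewrite coefD coefZ scalerDl scalerA.
Qed.

HB.instance Definition _ M (e : nat -> M) :=
  GRing.isLinear.Build R {poly R} M *:%R (lcomb e) (lcomb_is_linear e).

Lemma lcomb_poly M (e : nat -> M) n (c : nat -> R) :
  lcomb e (\poly_(j < n) c j) = \sum_(j < n) c j *: e j.
Proof.
rewrite (lcomb_widen _ (size_poly _ _)); apply: eq_bigr => j _.
by rewrite coef_poly ltn_ord.
Qed.

Lemma lcombXn M (e : nat -> M) j : lcomb e 'X^j = e j.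
Proof.
rewrite /lcomb size_polyXn big_ord_recr big1 /= => [|i _].
  by rewrite coefXn eqxx scale1r add0r.
by rewrite coefXn ltn_eqF // scale0r.
Qed.

Lemma eq_lcomb M (e e' : nat -> M) (u : {poly R}) :
  (forall j, (j < size u)%N -> e j = e' j) -> lcomb e u = lcomb e' u.
Proof. by move=> ee'; apply: eq_bigr => j _; rewrite ee'. Qed.

Lemma linear_lcomb M N (f : {linear M -> N}) (e : nat -> M) u :
  f (lcomb e u) = lcomb (f \o e) u.
Proof. by rewrite linear_sum; apply: eq_bigr => j _; rewrite linearZ. Qed.

Lemma lcombBl M (e e' : nat -> M) u :
  lcomb (fun j => e j - e' j) u = lcomb e u - lcomb e' u.
Proof. by rewrite -sumrB; apply: eq_bigr => j _; rewrite scalerBr. Qed.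

Lemma submodule_lcomb M (S : set M) (e : nat -> M) (u : {poly R}) :
  submodule S -> (forall j, (j < size u)%N -> S (e j)) -> S (lcomb e u).
Proof.
move=> sS Se; apply: submodule_sum => // j _.
by apply: submoduleZ => //; exact: Se.
Qed.

Lemma size_sub_top (u : {poly R}) k :
  (size u <= k.+1)%N -> (size (u - u`_k *: 'X^k)%R <= k)%N.
Proof.
move=> uk; apply/leq_sizeP => j; rewrite coefB coefZ coefXn leq_eqVlt.
move=> /predU1P[<-|kj]; first by rewrite eqxx mulr1 subrr.
by rewrite gtn_eqF // mulr0 subr0 nth_default // (leq_trans uk).
Qed.

End LinearCombinations.

Section RelationSystem.
Variable R : comNzRingType.
Implicit Types M E L : lmodType R.

(* The generators x_0, ..., x_{n-1}, y_0, y_1, ... are numbered consecutively,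
   the j-th one being encoded by 'X^j; [nfree] is n, [mult m] is p_m and
   [tail m] is \sum_i k_{im} x_i. *)
Record relation_system := RelationSystem {
  nfree : nat;
  mult : nat -> R;
  tail : nat -> {poly R};
  mult_neq0 : forall m, mult m != 0;
  size_tail : forall m, (size (tail m) <= nfree)%N
}.

Implicit Types D : relation_system.

Definition relator D m : {poly R} :=
  mult D m *: 'X^((nfree D + m).+1) - 'X^(nfree D + m) - tail D m.

Definition frame D M (e : nat -> M) : Prop :=
  forall u, lcomb e u = 0 <-> span_in (range (relator D)) u.

Definition solution D M (e z : nat -> M) : Prop :=
  forall m, lcomb e (relator D m) = z m.

Lemma lcomb_relator D M (e : nat -> M) m :
  lcomb e (relator D m) =
  mult D m *: e (nfree D + m)%N.+1 - e (nfree D + m)%N - lcomb e (tail D m).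
Proof. by rewrite !linearB linearZ /= !lcombXn. Qed.

Lemma span_relators_lcomb D M (e : nat -> M) (S : set M) u :
  submodule S -> (forall m, S (lcomb e (relator D m))) ->
  span_in (range (relator D)) u -> S (lcomb e u).
Proof.
move=> sS Se; apply: (@span_in_min _ _ _ (lcomb e @^-1` S)).
  exact: submodule_preimage.
by move=> _ [m _ <-]; exact: Se.
Qed.

Lemma frame_solution D M (e : nat -> M) : frame D e -> solution D e (fun=> 0).
Proof. by move=> fe m; apply/fe/sub_span_in; exists m. Qed.

Lemma generating_frame_lift D M E (e : nat -> M) (e' : nat -> E) :
  frame D e -> generating e -> solution D e' (fun=> 0) ->
  exists s : {linear M -> E}, forall u, s (lcomb e u) = lcomb e' u.
Proof.
move=> fe ge e'0; apply: linear_factor => // u /fe.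
exact: span_relators_lcomb (submodule_set0 E) e'0.
Qed.

Lemma generating_frame_embedding D M E (e : nat -> M) (e' : nat -> E) :
  frame D e -> generating e -> frame D e' ->
  exists2 s : {linear M -> E}, injective s &
    forall u, s (lcomb e u) = lcomb e' u.
Proof.
move=> fe ge fe'.
have [s sE] := generating_frame_lift fe ge (frame_solution fe').
exists s => // x y sxy; apply/eqP; rewrite -subr_eq0; apply/eqP.
have [u _ ue] : range (lcomb e) (x - y) by rewrite ge.
by rewrite -ue; apply/fe/fe'; rewrite -sE ue linearB sxy subrr.
Qed.

(* Lifting the generators to an extension of M by L turns each relation into an
   element of L; correcting the lift by a solution in L splits the extension. *)
Lemma Ext_zero_solvable D M L (e : nat -> M) :
  frame D e -> generating e ->
  (forall z : nat -> L, exists e' : nat -> L, solution D e' z) ->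
  Ext_zero M L.
Proof.
move=> fe ge solve E f0 g0 /is_lin_linear[f ->] /is_lin_linear[g ->] _ gS gf.
have gf0 l : g (f l) = 0 by apply/gf; exists l.
have /choice[h hP] := fun j => gS (e j).
have /choice[z zP] m : exists l, f l = lcomb h (relator D m).
  apply/gf; rewrite linear_lcomb -[RHS](frame_solution fe m).
  by apply: eq_lcomb => j _; exact: hP.
have [e' e'P] := solve z.
have [m|s sE] := generating_frame_lift (e' := fun j => h j - f (e' j)) fe ge.
  by rewrite (lcombBl h (f \o e')) -linear_lcomb e'P zP subrr.
exists s; split=> [|x]; first by move=> a x y; rewrite linearP.
have [u _ <-] : range (lcomb e) x by rewrite ge.
rewrite sE linear_lcomb; apply: eq_lcomb => j _ /=.
by rewrite linearB /= hP gf0 subr0.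
Qed.

Lemma relator_normal_form D N (u : {poly R}) : (size u <= nfree D + N.+1)%N ->
  exists (a : {poly R}) (b : R), (size a <= nfree D)%N /\
    span_in (range (relator D)) (u - (a + b *: 'X^(nfree D + N))).
Proof.
have sp := span_in_submodule (range (relator D)).
elim: N u => [|N IH] u uN.
  rewrite addn1 in uN; exists (u - u`_(nfree D) *: 'X^(nfree D)), u`_(nfree D).
  by rewrite size_sub_top // addn0 subrK subrr; split=> //; exact: submodule0.
rewrite addnS in uN; have [a [b [an ab]]] := IH _ (size_sub_top uN).
set c := u`_(nfree D + N.+1) in ab.
exists (a - b *: tail D N), (b * mult D N + c); split.
  rewrite (leq_trans (size_polyD _ _)) // geq_max an size_polyN.
  by rewrite (leq_trans (size_scale_leq _ _)) // size_tail.
have -> : u - (a - b *: tail D N + (b * mult D N + c) *: 'X^(nfree D + N.+1)) =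
    u - c *: 'X^(nfree D + N.+1) - (a + b *: 'X^(nfree D + N)) -
    b *: relator D N.
  rewrite addnS /relator !scalerBr scalerDl scalerA !opprD !opprK !addrA.
  rewrite [LHS](AC 5 (1*5*2*3*4)) [RHS](AC 7 (1*2*3*7*5*(4*6))) /=.
  by rewrite addNr addr0.
apply: (submoduleB sp) => //; apply: (submoduleZ sp).
by apply: sub_span_in; exists N.
Qed.

Lemma pure_solution D M (S : set M) (e : nat -> M) :
  submodule S -> pure S -> (forall j, (j <= nfree D)%N -> S (e j)) ->
  (forall m, S (lcomb e (relator D m))) -> forall j, S (e j).
Proof.
move=> sS pS Se Sr j; have [/Se//|/ltnW/subnKC <-] := leqP j (nfree D).
elim: (j - _)%N => [|m IH]; first by apply: Se; rewrite addn0.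
apply: (pS _ _ (mult_neq0 D m)); rewrite addnS.
have -> : mult D m *: e (nfree D + m)%N.+1 =
    lcomb e (relator D m) + (e (nfree D + m)%N + lcomb e (tail D m)).
  by rewrite lcomb_relator addrA (addrAC _ _ (e (nfree D + m)%N)) !subrK.
do 2?[apply: submoduleD => //]; apply: submodule_lcomb => // i it.
by apply/Se/ltnW/(leq_trans it); exact: size_tail.
Qed.

Hypothesis R_domain : GRing.integral_domain_axiom R.

Lemma solution_multiple D M (e : nat -> M) N :
  solution D e (fun=> 0) ->
  exists2 d : R, d != 0 & exists2 c : {poly R}, (size c <= nfree D)%N &
    d *: e (nfree D + N)%N = e (nfree D) + lcomb e c.
Proof.
move=> e0; elim: N => [|N [d d0 [c cn de]]].
  exists 1; [exact: oner_neq0|exists 0; first by rewrite size_poly0].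
  by rewrite addn0 scale1r linear0 addr0.
exists (d * mult D N); first exact: domain_mulf_neq0 (mult_neq0 D N).
exists (c + d *: tail D N).
  rewrite (leq_trans (size_polyD _ _)) // geq_max cn.
  by rewrite (leq_trans (size_scale_leq _ _)) // size_tail.
rewrite addnS linearD linearZ addrA -de -scalerA -scalerDr; congr (_ *: _).
by apply/eqP; rewrite -subr_eq0 opprD addrA -lcomb_relator e0.
Qed.

Lemma solution_frame D M (e : nat -> M) :
  solution D e (fun=> 0) ->
  (forall u : {poly R}, (size u <= (nfree D).+1)%N -> lcomb e u = 0 -> u = 0) ->
  frame D e.
Proof.
move=> e0 e_free u.
split; last exact: span_relators_lcomb (submodule_set0 M) e0.
have uN : (size u <= nfree D + (size u).+1)%N by rewrite addnS leqW ?leq_addl.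
have [a [b [an ab]]] := relator_normal_form uN => u0.
have [d d0 [c cn de]] := solution_multiple (size u) e0.
have w0 : d *: a + b *: c + b *: 'X^(nfree D) = 0.
  apply: e_free.
    rewrite (leq_trans (size_polyD _ _)) // geq_max.
    rewrite (leq_trans (size_scale_leq _ _)) ?size_polyXn // andbT.
    rewrite (leq_trans (size_polyD _ _)) // geq_max.
    by rewrite !(leq_trans (size_scale_leq _ _)) // leqW.
  have ab0 : lcomb e (a + b *: 'X^(nfree D + size u)) = 0.
    have := span_relators_lcomb (submodule_set0 M) e0 ab.
    by rewrite /set1 /= linearB /= u0 sub0r => /eqP; rewrite oppr_eq0 => /eqP.
  rewrite -addrA -scalerDr linearD !linearZ linearD /= lcombXn.
  rewrite [lcomb e c + _]addrC -de.
  rewrite scalerA mulrC -scalerA -scalerDr -[RHS](scaler0 _ d) -ab0.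
  by rewrite [lcomb e (a + _)]linearD linearZ /= lcombXn.
have b0 : b = 0.
  have := congr1 (fun v : {poly R} => v`_(nfree D)) w0.
  rewrite coef0 !coefD !coefZ coefXn eqxx mulr1.
  by rewrite !(nth_default 0) ?mulr0 ?add0r.
have a0 : a = 0.
  apply/polyP => j; have := congr1 (fun v : {poly R} => v`_j) w0.
  rewrite b0 !scale0r !addr0 coefZ coef0 => /R_domain.
  by rewrite (negPf d0) => /eqP.
by rewrite a0 b0 scale0r addr0 subr0 in ab.
Qed.

End RelationSystem.

Section Presentation.
Variable R : comNzRingType.
Implicit Types M : lmodType R.

Lemma sum_ord_cond M (F : nat -> M) n k :
  \sum_(i < k | (i < n)%N) F i = \sum_(i < n) (if (i < k)%N then F i else 0).
Proof.
rewrite -big_mkcond -(big_mkord (fun i => i < n)%N F).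
rewrite -(big_mkord (fun i => i < k)%N F).
rewrite (big_nat_widen 0 k (maxn n k)) ?leq_maxr //.
rewrite [RHS](big_nat_widen 0 n (maxn n k)) ?leq_maxl //.
by apply: eq_bigl => i; rewrite andbC.
Qed.

Definition splice (T : Type) n (x y : nat -> T) j :=
  if (j < n)%N then x j else y (j - n)%N.

Lemma splice_small T n (x y : nat -> T) j : (j < n)%N -> splice n x y j = x j.
Proof. by rewrite /splice => ->. Qed.

Lemma splice_large T n (x y : nat -> T) j : splice n x y (n + j) = y j.
Proof. by rewrite /splice ltnNge leq_addr addKn. Qed.

Lemma lcomb_splice M n k (x y : nat -> M) (u : {poly R}) :
  (size u <= n + k)%N ->
  lcomb (splice n x y) u =
  \sum_(i < n) u`_i *: x i + \sum_(m < k) u`_(n + m) *: y m.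
Proof.
move=> uk; rewrite (lcomb_widen _ uk) big_split_ord; congr (_ + _).
  by apply: eq_bigr => i _; rewrite /= splice_small.
by apply: eq_bigr => m _; rewrite /= splice_large.
Qed.

Lemma relator_sum (D : relation_system R) (c : nat -> R) k :
  \sum_(m < k) c m *: relator D m =
  (\poly_(m < k) (c m * mult D m) * 'X - \poly_(m < k) c m) * 'X^(nfree D) -
  \sum_(m < k) c m *: tail D m.
Proof.
rewrite !poly_def mulrBl !mulr_suml -!sumrB; apply: eq_bigr => m _.
rewrite /relator !scalerBr scalerA -!scalerAl -exprSr -!exprD.
by rewrite ![(nfree D + _)%N]addnC addSn.
Qed.

Lemma eq_relator_sum (D : relation_system R) (c : nat -> R) k (u : {poly R}) :
  (forall m, (k <= m)%N -> c m = 0) ->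
  (forall i, (i < nfree D)%N -> u`_i = - \sum_(m < k) c m * (tail D m)`_i) ->
  (forall m, u`_(nfree D + m) =
     (if m is m'.+1 then c m' * mult D m' else 0) - c m) ->
  u = \sum_(m < k) c m *: relator D m.
Proof.
move=> c0 u_low u_high; apply/polyP => j.
rewrite relator_sum coefB coefMXn coef_sum.
have [jn|nj] := ltnP j (nfree D).
  by rewrite u_low // sub0r; congr (- _); apply: eq_bigr => m _; rewrite coefZ.
rewrite [X in _ - X]big1 ?subr0 => [|m _]; last first.
  by rewrite coefZ (nth_default 0) ?mulr0 // (leq_trans (size_tail D m)).
rewrite -{1}(subnKC nj) u_high coefB coefMX !coef_poly.
case: (j - _)%N => [|m] /=; first by case: ltnP => // /c0 ->.
by congr (_ - _); case: ltnP => // /c0 ->; rewrite ?mul0r.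
Qed.

Lemma presented_by_frame n M : presented_by (Some n) M ->
  exists D (e : nat -> M), [/\ nfree D = n, frame D e & generating e].
Proof.
move=> [x [y [p [k [bnd [p0 kn kb [rel gen ker]]]]]]].
pose D := @RelationSystem R n p (fun m => \poly_(i < n) k i m) p0
  (fun m => size_poly n (k^~ m)).
exists D, (splice n x y); split=> //.
  move=> u; split=> [u0|]; last first.
    apply: (span_relators_lcomb (submodule_set0 M)) => m; rewrite /set1 /=.
    rewrite lcomb_relator /D /= -addnS !splice_large lcomb_poly -[RHS](rel m).
    congr (_ - _); transitivity (\sum_(i < bnd m | (i < n)%N) k i m *: x i).
      rewrite (sum_ord_cond (fun i => k i m *: x i)); apply: eq_bigr => i _.
      by rewrite splice_small //; case: ltnP => // /kb ->; rewrite scale0r.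
    rewrite big_mkcond; apply: eq_bigr => i _; case: ifP => // /negbT/kn ->.
    by rewrite scale0r.
  pose s := (n + size u)%N.
  have [|L [c [c0 ca cb]]] := ker s (fun i => u`_i) (fun m => u`_(n + m)).
    rewrite (sum_ord_cond (fun i => u`_i *: x i)).
    rewrite -[RHS]u0 (@lcomb_splice _ n s).
      by congr (_ + _); apply: eq_bigr => i _; rewrite ltn_addr.
    by rewrite /s addnA leq_addl.
  rewrite (@eq_relator_sum D c L u) // => [|i iltn|m].
  - apply: submodule_sum => [|m _]; first exact: span_in_submodule.
    apply: submoduleZ; first exact: span_in_submodule.
    by apply: sub_span_in; exists m.
  - have := ca i iltn; rewrite ltn_addr // => ->; congr (- _).
    by apply: eq_bigr => m _; rewrite coef_poly iltn.
  - rewrite -cb /=; case: ltnP => // sm; apply: nth_default.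
    by rewrite (leq_trans _ (leq_trans sm (leq_addl n m))) ?leq_addl.
apply/seteqP; split=> // g _; have [l [a [b ->]]] := gen g.
pose c j := splice n (fun i => if (i < l)%N then a i else 0) b j.
exists (\poly_(j < n + l) c j) => //.
rewrite (@lcomb_splice _ n l) ?size_poly //.
rewrite (sum_ord_cond (fun i => a i *: x i)).
congr (_ + _); apply: eq_bigr => i _; rewrite coef_poly /c.
  by rewrite splice_small // ltn_addr //; case: ifP; rewrite ?scale0r.
by rewrite splice_large ltn_add2l ltn_ord.
Qed.

End Presentation.

(** * Realization over the field of fractions *)

Definition frac_mod (R : comNzRingType) (F : fieldType)
  (iota : {rmorphism R -> F}) : Type := F.

Section FractionModule.
Variables (R : comNzRingType) (F : fieldType) (iota : {rmorphism R -> F}).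

HB.instance Definition _ := GRing.Field.on (frac_mod iota).

Definition frac_scale (r : R) (q : frac_mod iota) : frac_mod iota := iota r * q.

Fact frac_scaleA a b q : frac_scale a (frac_scale b q) = frac_scale (a * b) q.
Proof. by rewrite /frac_scale rmorphM mulrA. Qed.
Fact frac_scale1 : left_id 1 frac_scale.
Proof. by move=> q; rewrite /frac_scale rmorph1 mul1r. Qed.
Fact frac_scaleDr : right_distributive frac_scale +%R.
Proof. by move=> a q q'; exact: mulrDr. Qed.
Fact frac_scaleDl q : {morph frac_scale^~ q : a b / a + b}.
Proof. by move=> a b; rewrite /frac_scale rmorphD mulrDl. Qed.

HB.instance Definition _ := GRing.Zmodule_isLmodule.Build R (frac_mod iota)
  frac_scaleA frac_scale1 frac_scaleDr frac_scaleDl.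

Lemma frac_scaleE Z r (f : Z -> frac_mod iota) z : (r *: f) z = iota r * f z.
Proof. by []. Qed.

End FractionModule.

Section FractionField.
Variables (R : comNzRingType) (F : fieldType) (iota : {rmorphism R -> F}).
Hypothesis iota_inj : injective iota.
Hypothesis iota_frac :
  forall q : F, exists2 d : R, d != 0 & exists c, iota c = iota d * q.

Local Notation fracs Z := (Z -> frac_mod iota).

Lemma iota_eq0 r : (iota r == 0) = (r == 0).
Proof. by rewrite -(inj_eq iota_inj) rmorph0. Qed.

Lemma frac_domain : GRing.integral_domain_axiom R.
Proof.
by move=> a b ab0; rewrite -!iota_eq0 -mulf_eq0 -rmorphM ab0 rmorph0.
Qed.

Lemma common_denominator (s : seq F) :
  exists2 d : R, d != 0 & forall q, q \in s -> exists c, iota c = iota d * q.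
Proof.
elim: s => [|q s [d d0 dP]]; first by exists 1; rewrite ?oner_eq0.
have [d' d'0 [c cE]] := iota_frac q; exists (d * d').
  exact: domain_mulf_neq0 frac_domain _ _ d0 d'0.
move=> q'; rewrite inE rmorphM => /orP[/eqP ->|/dP[c' c'E]].
  by exists (d * c); rewrite rmorphM cE mulrA.
by exists (c' * d'); rewrite rmorphM c'E mulrAC.
Qed.

Lemma fracs_torsion_free Z : torsion_free (fracs Z).
Proof.
move=> r f rf0; have [->|r0] := eqVneq r 0; [by left|right; apply/funext => z].
have /eqP := congr1 (fun g : fracs Z => g z) rf0.
by rewrite frac_scaleE mulf_eq0 iota_eq0 (negPf r0) => /eqP.
Qed.

Lemma independent_size_le m (s : seq (fracs 'I_m)) :
  uniq s -> independent [set` s] -> (size s <= m)%N.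
Proof.
move=> us /(_ s) iS; rewrite leqNgt; apply/negP => ms.
pose A : 'M[F]_(size s, m) := \matrix_(t, j) s`_t j.
have : kermx A != 0.
  rewrite -mxrank_eq0 mxrank_ker subn_eq0 -ltnNge.
  exact: leq_ltn_trans (rank_leq_col A) ms.
case/rowV0Pn=> u /sub_kermxP uA /eqP[]; apply/rowP => t; rewrite mxE.
have [d d0 dP] := common_denominator [seq u 0 j | j <- enum 'I_(size s)].
have /choice[c cP] j : exists c, iota c = iota d * u 0 j.
  by apply: dP; rewrite map_f ?mem_enum.
have := iS (fun j => if insub j is Some j' then c j' else 0) us.
move=> /(_ (fun j => @mem_nth _ 0 s j)) /(_ _ t (ltn_ord t)).
rewrite valK => c0.
have /eqP := cP t; rewrite c0 ?rmorph0.
  by rewrite eq_sym mulf_eq0 iota_eq0 (negPf d0) => /eqP.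
apply/funext => j; rewrite fct_sumE.
have := congr1 (fun B : 'rV[F]_m => iota d * B 0 j) uA.
rewrite !mxE mulr0 mulr_sumr => uA0; etransitivity; last exact: uA0.
apply: eq_bigr => i _.
by rewrite valK /= frac_scaleE cP mxE mulrA.
Qed.

Definition delta (Z : eqType) (z : Z) : fracs Z := fun w => (w == z)%:R.

Lemma deltaE (Z : eqType) (z : Z) : delta z z = 1.
Proof. by rewrite /delta eqxx. Qed.

Lemma delta_neq (Z : eqType) (z w : Z) : w != z -> delta z w = 0.
Proof. by rewrite /delta => /negPf ->. Qed.

Lemma delta_inj (Z : eqType) : injective (@delta Z).
Proof.
move=> z w zw; apply/eqP; apply: contraT => /delta_neq zw0.
by have := oner_neq0 F; rewrite -(deltaE z) zw zw0 eqxx.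
Qed.

Lemma independent_delta (Z : eqType) : independent (range (@delta Z)).
Proof.
apply/independentP => s c us sd sc0 _ /[dup] /sd[z _ <-] zs.
have := congr1 (fun f : fracs Z => f z) sc0.
rewrite fct_sumE (bigD1_seq _ zs us) /=.
rewrite big_seq_cond big1 => [|f /andP[/sd[w _ <-] wz]]; last first.
  by rewrite frac_scaleE delta_neq ?mulr0 //; apply: contraNneq wz => ->.
by rewrite frac_scaleE deltaE mulr1 addr0 => /eqP; rewrite iota_eq0 => /eqP.
Qed.

Lemma lcomb_delta_coord k (e : nat -> fracs 'I_k) (u : {poly R}) (i : 'I_k) :
  (forall j : 'I_k, e j = delta j) -> (size u <= k)%N ->
  lcomb e u i = iota u`_i.
Proof.
move=> eE uk; rewrite (lcomb_widen _ uk) fct_sumE (bigD1 i) //= big1 => [|j ji].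
  by rewrite eE frac_scaleE deltaE mulr1 addr0.
by rewrite eE frac_scaleE delta_neq ?mulr0 // eq_sym.
Qed.

Lemma delta_solution_frame D (e : nat -> fracs 'I_(nfree D).+1) :
  (forall j : 'I_(nfree D).+1, e j = delta j) ->
  solution D e (fun=> 0) -> frame D e.
Proof.
move=> e_delta e0; apply: solution_frame => //; first exact: frac_domain.
move=> u uD u0; apply/polyP => j; rewrite coef0.
have [jD|Dj] := ltnP j (nfree D).+1; last first.
  by rewrite nth_default // (leq_trans uD).
apply/eqP; rewrite -iota_eq0 -[j]/(val (Ordinal jD)).
by rewrite -(lcomb_delta_coord _ e_delta uD) u0.
Qed.

Section Solve.
Variables (D : relation_system R) (Z : Type).
Variables (b : 'I_(nfree D).+1 -> fracs Z) (z : nat -> fracs Z).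

Fixpoint solve_tail m : fracs Z :=
  if m is m'.+1 then
    fun w => (solve_tail m' + lcomb (b \o inord) (tail D m') + z m') w
             / iota (mult D m')
  else b ord_max.

Definition solve : nat -> fracs Z := splice (nfree D) (b \o inord) solve_tail.

Lemma solve_init (j : 'I_(nfree D).+1) : solve j = b j.
Proof.
rewrite /solve; have [jD|Dj] := ltnP j (nfree D).
  by rewrite splice_small //= inord_val.
have jE : j = (nfree D + 0)%N :> nat.
  by apply/eqP; rewrite addn0 eqn_leq -ltnS ltn_ord.
by rewrite jE splice_large; congr b; apply: val_inj; rewrite /= jE addn0.
Qed.

Lemma solve_solution : solution D solve z.
Proof.
move=> m; rewrite lcomb_relator {1 2}/solve -addnS !splice_large.
have -> : lcomb solve (tail D m) = lcomb (b \o inord) (tail D m).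
  apply: eq_lcomb => j jt; rewrite /solve splice_small //.
  exact: leq_trans jt (size_tail D m).
have -> : mult D m *: solve_tail m.+1 =
    solve_tail m + lcomb (b \o inord) (tail D m) + z m.
  apply/funext => w; rewrite frac_scaleE mulrC divfK //.
  by rewrite iota_eq0 mult_neq0.
by rewrite -addrA -opprD addrC addKr.
Qed.

End Solve.

Lemma frame_rank_at_least D (M : lmodType R) (e : nat -> M) k :
  frame D e -> generating e -> rank_at_least M k -> (k <= (nfree D).+1)%N.
Proof.
move=> fe ge [s [us <- iS]].
pose d := solve (D := D) (@delta _) (fun=> 0).
have fd : frame D d.
  apply: delta_solution_frame; first exact: solve_init.
  exact: solve_solution.
have [psi psi_inj _] := generating_frame_embedding fe ge fd.
rewrite -(size_map psi); apply: independent_size_le.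
  by rewrite map_inj_uniq.
apply: independentS (independent_image psi_inj iS).
by move=> _ /mapP[x xs ->]; exists x.
Qed.

End FractionField.

(** * Well-orders *)

Definition strict_well_order (T : Type) (lt : T -> T -> Prop) : Prop :=
  [/\ forall a b c, lt a b -> lt b c -> lt a c, forall a, ~ lt a a,
      forall a b, a = b \/ lt a b \/ lt b a & well_founded lt].

Definition weak (T : Type) (lt : T -> T -> Prop) (a b : T) : Prop :=
  a = b \/ lt a b.

Definition with_top (T : Type) (lt : T -> T -> Prop) (a b : option T) : Prop :=
  match a, b with
  | Some a, Some b => lt a b
  | Some _, None => True
  | None, _ => False
  end.

Section StrictWellOrder.
Variables (T : Type) (lt : T -> T -> Prop).
Hypothesis lt_wo : strict_well_order lt.

Lemma swo_trans a b c : lt a b -> lt b c -> lt a c.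
Proof. by case: lt_wo => + _ _ _; apply. Qed.

Lemma swo_irr a : ~ lt a a. Proof. by case: lt_wo. Qed.

Lemma swo_wf : well_founded lt. Proof. by case: lt_wo. Qed.

Lemma weak_or_lt a b : weak lt a b \/ lt b a.
Proof.
by case: lt_wo => _ _ /(_ a b) [->|[]]; [left; left|left; right|right].
Qed.

Lemma weak_lt_trans a b c : weak lt a b -> lt b c -> lt a c.
Proof. by case=> [->//|/swo_trans]; apply. Qed.

Lemma weak_trans a b c : weak lt a b -> weak lt b c -> weak lt a c.
Proof. by move=> ab [<- //|bc]; right; exact: weak_lt_trans bc. Qed.

Lemma weak_directed (P : set T) a b : P a -> P b ->
  exists2 c, P c & weak lt a c /\ weak lt b c.
Proof.
move=> Pa Pb; have [ab|ba] := weak_or_lt a b.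
  by exists b => //; split=> //; left.
by exists a => //; split; [left|right].
Qed.

Lemma with_top_wo : strict_well_order (with_top lt).
Proof.
have wfS a : Acc (with_top lt) (Some a).
  elim/(well_founded_ind swo_wf): a => a IH; constructor=> -[b ba|[]].
  exact: (IH b ba).
split.
- by move=> [a|] [b|] [c|] //=; exact: swo_trans.
- by move=> [a|] //=; exact: swo_irr.
- move=> [a|] [b|] /=; [|by right; left|by right; right|by left].
  by case: lt_wo => _ _ /(_ a b) [->|[]]; [left|right; left|right; right].
- by case=> [a|]; [exact: wfS|constructor=> -[b _|[]]; exact: wfS].
Qed.

End StrictWellOrder.

Lemma exists_strict_well_order (T : eqType) :
  exists lt : T -> T -> Prop, strict_well_order lt.
Proof.
have [r rwo] := well_ordering_principle T.
have rchain : wo_chain r predT by move=> A _; exact: rwo.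
have rtot x y : r x y || r y x by exact: (wo_chainW rchain).
have ranti x y : r x y -> r y x -> x = y.
  by move=> xy yx; apply: (wo_chain_antisymmetric rchain); rewrite ?xy.
have rP (P : pred T) x : P x -> exists2 z, P z & forall y, P y -> r z y.
  by move=> Px; have [|z [[Pz zmin] _]] := rwo P; [exists x|exists z].
exists (fun a b => ~~ r b a); split.
- move=> a b c nba ncb; apply/negP => ca.
  have [z + zmin] := rP (mem [:: a; b; c]) a (mem_head _ _).
  rewrite /= !inE => /or3P[] /eqP zE; rewrite {z}zE in zmin.
  + have ac : r a c by apply: zmin; rewrite /= !inE eqxx !orbT.
    by move: ncb (rtot a b); rewrite (ranti _ _ ca ac) (negPf nba) => /negPf ->.
  + by case/negP: nba; apply: zmin; rewrite /= mem_head.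
  + by case/negP: ncb; apply: zmin; rewrite /= !inE eqxx orbT.
- by move=> a; case/orP: (rtot a a) => ->.
- move=> a b; have [ba|nba] := boolP (r b a); last by right; left.
  by have [ab|nab] := boolP (r a b); [left; exact: ranti|right; right].
- move=> a; apply: contrapT => /asboolP na.
  have [z /asboolP nz zmin] :=
    rP (fun x => `[< ~ Acc (fun a b => ~~ r b a) x >]) a na.
  apply: nz; constructor=> y /negP nzy; apply: contrapT => ny.
  by apply/nzy/zmin; exact/asboolP.
Qed.

(* Elements are first compared by their well-founded rank, ties being broken by
   an arbitrary well-order. *)
Section ExtendWellFounded.
Variables (T : eqType) (child : T -> T -> Prop).
Hypothesis child_wf : well_founded child.

Inductive rank_le : T -> T -> Prop :=
  RankLe a b :
    (forall c, child c a -> exists2 d, child d b & rank_le c d) -> rank_le a b.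

Definition rank_lt a b : Prop := exists2 c, child c b & rank_le a c.

Lemma rank_leP a b : rank_le a b -> forall c, child c a -> rank_lt c b.
Proof. by case. Qed.

Lemma rank_le_trans a b c : rank_le a b -> rank_le b c -> rank_le a c.
Proof.
elim/(well_founded_ind child_wf): a b c => a IH b c ab bc; constructor=> d da.
have [e eb de] := rank_leP ab da; have [f fc ef] := rank_leP bc eb.
by exists f => //; exact: IH ef.
Qed.

Lemma rank_le_or_lt a b : rank_le a b \/ rank_lt b a.
Proof.
elim/(well_founded_ind child_wf): a b => a IH b.
have [ab|nab] := pselect (rank_le a b); [by left|right].
apply: contrapT => nba; apply: nab; constructor=> c ca; apply: contrapT => nc.
apply: nba; exists c => //; constructor=> d db.
by have [cd|//] := IH c ca d; exfalso; apply: nc; exists d.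
Qed.

Lemma child_rank_le c b : child c b -> rank_le c b.
Proof.
elim/(well_founded_ind child_wf): c b => c IH b cb; constructor=> d dc.
by exists c => //; exact: IH.
Qed.

Lemma rank_ltW a b : rank_lt a b -> rank_le a b.
Proof. by move=> [c cb ac]; exact: rank_le_trans ac (child_rank_le cb). Qed.

Lemma rank_lt_le_trans a b c : rank_lt a b -> rank_le b c -> rank_lt a c.
Proof.
move=> [d db ad] /rank_leP/(_ _ db)[e ec de]; exists e => //.
exact: rank_le_trans de.
Qed.

Lemma rank_le_lt_trans a b c : rank_le a b -> rank_lt b c -> rank_lt a c.
Proof. by move=> ab [d dc bd]; exists d => //; exact: rank_le_trans bd. Qed.

Lemma rank_lt_wf : well_founded rank_lt.
Proof.
suff acc_le b a : rank_le a b -> Acc rank_lt a.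
  move=> a; have [aa|[c ca ac]] := rank_le_or_lt a a; first exact: acc_le aa.
  exact: acc_le ac.
elim/(well_founded_ind child_wf): b a => b IH a ab; constructor=> y [c ca yc].
have [d db cd] := rank_leP ab ca; apply: IH db _ _.
exact: rank_le_trans cd.
Qed.

Lemma rank_lt_irr a : ~ rank_lt a a.
Proof.
by elim/(well_founded_ind rank_lt_wf): a => a IH aa; exact: (IH a aa aa).
Qed.

Lemma rank_le_refl a : rank_le a a.
Proof. by have [//|/rank_lt_irr] := rank_le_or_lt a a. Qed.

Lemma extend_well_founded : exists2 lt : T -> T -> Prop,
  strict_well_order lt & forall c b, child c b -> lt c b.
Proof.
have [wo wo_swo] := exists_strict_well_order T.
have [wo_trans wo_irr wo_total wo_wf] := wo_swo.
pose lt a b := rank_lt a b \/ [/\ rank_le a b, rank_le b a & wo a b].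
have child_lt c b : child c b -> lt c b.
  by move=> cb; left; exists c => //; exact: rank_le_refl.
exists lt; last exact: child_lt.
split.
- move=> a b c [ab|[ab ba wab]] [bc|[bc cb wbc]].
  + by left; apply: rank_lt_le_trans ab (rank_ltW bc).
  + by left; exact: rank_lt_le_trans bc.
  + by left; exact: rank_le_lt_trans bc.
  + right; split; last exact: wo_trans wbc.
      exact: rank_le_trans bc.
    exact: rank_le_trans ba.
- by move=> a [/rank_lt_irr|[_ _ /wo_irr]].
- move=> a b; have [ab|ba] := rank_le_or_lt a b; last by right; right; left.
  have [ba|ab'] := rank_le_or_lt b a; last by right; left; left.
  have [->|[wab|wba]] := wo_total a b; first by left.
    by right; left; right.
  by right; right; right.
- elim/(well_founded_ind rank_lt_wf) => a IH.
  suff tied b : rank_le b a -> rank_le a b -> Acc lt b.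
    exact: tied (rank_le_refl a) (rank_le_refl a).
  elim/(well_founded_ind wo_wf): b => b IHb ba ab.
  constructor=> y [yb|[yb b_y wyb]].
    by apply: IH; exact: rank_lt_le_trans ba.
  by apply: IHb => //; [exact: rank_le_trans ba|exact: rank_le_trans b_y].
Qed.

End ExtendWellFounded.

(** * The module generated by a system of nodes *)

Section SubmoduleType.
Variables (R : comNzRingType) (V : lmodType R) (S : set V).

Definition submod_pred : {pred V} := fun v => `[< S v >].

Record submod (sS : submodule S) :=
  Submod { submod_val : V; _ : submod_val \in submod_pred }.

Variable sS : submodule S.
HB.instance Definition _ := [isSub of submod sS for @submod_val sS].
HB.instance Definition _ := [Choice of submod sS by <:].

Fact submod_pred_closed : submod_closed submod_pred.
Proof.
split=> [|a u v]; first by apply/asboolP; case: sS.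
by move=> /asboolP Su /asboolP Sv; apply/asboolP/sS.2.
Qed.

HB.instance Definition _ :=
  GRing.SubChoice_isSubLmodule.Build R V submod_pred (submod sS)
    submod_pred_closed.

Lemma submod_valP (u : submod sS) : S (val u).
Proof. by have /asboolP := valP u. Qed.

Definition in_submod v (Sv : S v) : submod sS :=
  Submod sS (introT (asboolP _) Sv).

End SubmoduleType.

Section GeneratedByNodes.
Variables (R : comNzRingType) (M : lmodType R) (T : Type) (gen : T -> nat -> M).
Implicit Types (P Q : set T) (S : set M).

Definition gen_span P : set M := span_in [set gen v j | v in P & j in setT].

Lemma gen_span_submodule P : submodule (gen_span P).
Proof. exact: span_in_submodule. Qed.

Lemma gen_span_gen P v j : P v -> gen_span P (gen v j).
Proof. by move=> Pv; apply: sub_span_in; exists v => //; exists j. Qed.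

Lemma gen_span_lcomb P v u : P v -> gen_span P (lcomb (gen v) u).
Proof.
move=> Pv; apply: submodule_lcomb => [|j _]; first exact: gen_span_submodule.
exact: gen_span_gen.
Qed.

Lemma gen_span_min P S :
  submodule S -> (forall v j, P v -> S (gen v j)) -> gen_span P `<=` S.
Proof.
by move=> sS SP; apply: span_in_min => // _ [v Pv [j _ <-]]; exact: SP.
Qed.

Lemma gen_spanS P Q : P `<=` Q -> gen_span P `<=` gen_span Q.
Proof.
move=> PQ; apply: gen_span_min => [|v j /PQ]; first exact: gen_span_submodule.
exact: gen_span_gen.
Qed.

Lemma gen_span_set0 w : gen_span set0 w -> w = 0.
Proof. exact: (@gen_span_min _ [set 0] (submodule_set0 M)). Qed.

Variable lt : T -> T -> Prop.
Hypothesis lt_wo : strict_well_order lt.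

Lemma gen_spanW a b :
  weak lt a b -> gen_span (weak lt ^~ a) `<=` gen_span (weak lt ^~ b).
Proof. by move=> ab; apply: gen_spanS => c ca; exact: weak_trans ca ab. Qed.

Lemma gen_span_max P a0 w : P a0 -> gen_span P w ->
  exists2 a, P a & gen_span (weak lt ^~ a) w.
Proof.
move=> Pa0; have sp a := gen_span_submodule (weak lt ^~ a).
apply: (@gen_span_min P (fun w => exists2 a, P a & gen_span (weak lt ^~ a) w)).
  split=> [|r x y [a Pa ax] [b Pb b_y]].
    by exists a0 => //; exact: submodule0.
  have [c Pc [ac bc]] := weak_directed lt_wo Pa Pb.
  exists c => //; apply: (sp c).2; first exact: gen_spanW ax.
  exact: gen_spanW b_y.
by move=> v j Pv; exists v => //; apply: gen_span_gen; left.
Qed.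

Lemma gen_span_seq_max P a0 (s : seq M) : P a0 -> [set` s] `<=` gen_span P ->
  exists2 a, P a & [set` s] `<=` gen_span (weak lt ^~ a).
Proof.
move=> Pa0; elim: s => [|x s IH] sP; first by exists a0.
have [|a Pa as_] := IH; first by move=> y ys; apply: sP; rewrite /= inE ys orbT.
have [b Pb bx] := gen_span_max Pa0 (sP x (mem_head _ _)).
have [c Pc [ac bc]] := weak_directed lt_wo Pa Pb.
exists c => // y /=; rewrite inE => /orP[/eqP ->|/as_ ay].
  exact: gen_spanW bx.
exact: gen_spanW ay.
Qed.

End GeneratedByNodes.

Section NodeSystem.
Variables (R : comNzRingType) (F : fieldType) (iota : {rmorphism R -> F}).
Variables (I : Type) (D : I -> relation_system R).

Definition coordinate (T : Type) (label : T -> I) : Type :=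
  {v : T & 'I_(nfree (D (label v))).+1}.

(* The relations of a node hold up to errors generated by lower nodes. As every
   sequence of errors occurs at some node, the relations of [D i] with arbitrary
   errors are solvable in the module generated by all nodes. *)
Record node_system := NodeSystem {
  node : eqType;
  label : node -> I;
  lt_node : node -> node -> Prop;
  gen : node -> nat -> coordinate label -> frac_mod iota;
  lt_node_wo : strict_well_order lt_node;
  gen_init : forall v (j : 'I_(nfree (D (label v))).+1),
    gen v j = delta iota (existT _ v j);
  gen_relator_below : forall v m,
    gen_span gen (lt_node ^~ v) (lcomb (gen v) (relator (D (label v)) m));
  gen_relator_onto : forall i (z : nat -> coordinate label -> frac_mod iota),
    (forall m, gen_span gen setT (z m)) ->
    exists v, solution (D i) (gen v) z
}.

Definition node_coordinate (X : node_system) : Type :=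
  coordinate (@label X).

Definition tower (X : node_system) : lmodType R :=
  submod (gen_span_submodule (gen (n := X)) setT).

End NodeSystem.

Section Tower.
Variables (R : comNzRingType) (F : fieldType) (iota : {rmorphism R -> F}).
Hypothesis iota_inj : injective iota.
Variables (I : Type) (Phi : I -> lmodType R) (D : I -> relation_system R).
Variable e : forall i, nat -> Phi i.
Hypothesis e_frame : forall i, frame (D i) (e i).
Hypothesis e_generating : forall i, generating (e i).
Variable X : node_system iota D.

Local Notation n v := (nfree (D (label v))).
Local Notation Z := (node_coordinate X).
Local Notation V := (Z -> frac_mod iota).
Local Notation lt := (@lt_node _ _ _ _ _ X).
Local Notation le := (weak lt).
Local Notation gen := (@gen _ _ _ _ _ X).
Local Notation node_wo := (lt_node_wo X).
Local Notation gspan := (gen_span gen).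
Local Notation G := (tower X).
Local Notation in_tower := (in_submod (gen_span_submodule gen setT)).
Implicit Types (P : set (node X)) (v a b : node X).

Definition down_closed P : Prop := forall a b, lt a b -> P b -> P a.

Lemma down_closed_lt v : down_closed (lt^~ v).
Proof. by move=> a b /(swo_trans node_wo) ab /ab. Qed.

Lemma down_closed_le v : down_closed (le^~ v).
Proof.
move=> a b ab bv; right; case: bv ab => [->//|bv ab].
exact: down_closed_lt bv.
Qed.

Lemma gen_span_sub_pure P (S : set V) :
  submodule S -> pure S -> down_closed P ->
  (forall v j, P v -> S (delta iota (existT _ v j))) -> gspan P `<=` S.
Proof.
move=> sS pS lP Sdelta; apply: gen_span_min => //.
elim/(well_founded_ind (swo_wf node_wo)) => v IH + Pv.
apply: (@pure_solution _ (D (label v))) => // [j jn|m].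
  by rewrite -ltnS in jn; rewrite (gen_init (Ordinal jn)); exact: Sdelta.
apply: gen_span_min (gen_relator_below v m) => // u j uv.
by apply: IH => //; exact: lP uv Pv.
Qed.

Definition coords_at v (w : V) : 'I_(n v).+1 -> frac_mod iota :=
  fun j => w (existT _ v j).
Arguments coords_at : clear implicits.

Fact coords_at_is_linear v : linear (coords_at v).
Proof. by []. Qed.

HB.instance Definition _ v := GRing.isLinear.Build R V
  ('I_(n v).+1 -> frac_mod iota) *:%R (coords_at v) (coords_at_is_linear v).

Lemma coords_at_delta v (j : 'I_(n v).+1) :
  coords_at v (delta iota (existT _ v j)) = delta iota j.
Proof. by apply/funext => i; rewrite /coords_at /delta eq_Tagged. Qed.

Lemma coords_at_eq0 P w v :
  down_closed P -> ~ P v -> gspan P w -> coords_at v w = 0.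
Proof.
move=> lP nPv; apply: (@gen_span_sub_pure P (coords_at v @^-1` [set 0])) => //.
- exact/submodule_preimage/submodule_set0.
- apply: (@pure_preimage _ _ _ (coords_at v)).
  exact: (pure_set0 (fracs_torsion_free iota_inj (Z := _))).
move=> u j Pu; apply/funext => i; rewrite /coords_at delta_neq //.
by apply/eqP => /(congr1 tag) /= vu; rewrite vu in nPv.
Qed.

Lemma coords_at_lt_eq0 v w : gspan (lt^~ v) w -> coords_at v w = 0.
Proof. exact: coords_at_eq0 (@down_closed_lt v) (swo_irr node_wo (a:=v)). Qed.

Lemma coords_at_gen_frame v : frame (D (label v)) (coords_at v \o gen v).
Proof.
apply: delta_solution_frame => // [j|m] /=.
  by rewrite gen_init coords_at_delta.
by rewrite -linear_lcomb; exact/coords_at_lt_eq0/gen_relator_below.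
Qed.

Lemma gen_span_le_split v w : gspan (le^~ v) w ->
  exists u, gspan (lt^~ v) (w - lcomb (gen v) u).
Proof.
have sp := gen_span_submodule gen (lt^~ v).
apply: (@gen_span_min _ _ _ _ (le^~ v)
  (fun w => exists u, gspan (lt^~ v) (w - lcomb (gen v) u))).
  split=> [|r x y [u xu] [u' yu']].
    by exists 0; rewrite linear0 subr0; exact: submodule0.
  exists (r *: u + u'); rewrite linearP opprD addrACA -scalerBr.
  by apply: sp.2.
move=> a j [->|av].
  by exists 'X^j; rewrite lcombXn subrr; exact: submodule0.
by exists 0; rewrite linear0 subr0; exact: gen_span_gen.
Qed.

Lemma gen_span_le_lt v w :
  gspan (le^~ v) w -> coords_at v w = 0 -> gspan (lt^~ v) w.
Proof.
move=> /gen_span_le_split[u wu] w0; rewrite -(subrK (lcomb (gen v) u) w).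
have sp := gen_span_submodule gen (lt^~ v).
apply: (submoduleD sp) => //.
apply: (@span_relators_lcomb _ (D (label v))) => //.
  exact: gen_relator_below.
apply/(coords_at_gen_frame v); rewrite -linear_lcomb; apply/eqP.
have /eqP := coords_at_lt_eq0 wu.
by rewrite linearB /= w0 sub0r oppr_eq0.
Qed.

(* Descend along the nodes bounding [w]: at a node outside [P] the coordinates
   of [w] vanish, so [w] is generated by the nodes below it. *)
Lemma mem_gen_span_down_closed P w : down_closed P -> gspan setT w ->
  (forall v, ~ P v -> coords_at v w = 0) -> gspan P w.
Proof.
move=> lP gw w0; have [/gen_spanS|/existsNP[a0 _]] := pselect (setT `<=` P).
  exact.
have [a _] := gen_span_max node_wo (Logic.I : setT a0) gw.
elim/(well_founded_ind (swo_wf node_wo)): a => a IH ga.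
have [Pa|nPa] := pselect (P a).
  by apply: gen_spanS ga => v [->//|/lP]; exact.
have {}ga := gen_span_le_lt ga (w0 a nPa).
have [/gen_spanS|/existsNP[b /not_implyP[ba _]]] := pselect (lt^~ a `<=` P).
  exact.
by have [c ca /(IH c ca)] := gen_span_max node_wo (ba : (lt^~ a) b) ga.
Qed.

Lemma gen_span_down_closed_pure P d w :
  down_closed P -> d != 0 -> gspan setT w -> gspan P (d *: w) -> gspan P w.
Proof.
move=> lP d0 gw gdw; apply: mem_gen_span_down_closed => // v nPv.
have := coords_at_eq0 lP nPv gdw; rewrite linearZ /=.
by case/(fracs_torsion_free iota_inj) => // /eqP; rewrite (negPf d0).
Qed.

Lemma tower_torsion_free : torsion_free G.
Proof.
move=> r x rx; have := congr1 val rx; rewrite linearZ /=.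
by move=> /(fracs_torsion_free iota_inj)[|x0]; [left|right; exact: val_inj].
Qed.

Lemma tower_complete : Phi_complete Phi G.
Proof.
move=> i; apply: (Ext_zero_solvable (e_frame i) (e_generating i)) => z.
have [v vz] := gen_relator_onto i (fun m => submod_valP (z m)).
exists (fun j => in_tower (gen_span_gen gen j (Logic.I : setT v))).
by move=> m; apply: val_inj; rewrite (linear_lcomb val) -vz.
Qed.

Definition below P : set G := val @^-1` gspan P.

Lemma below_submodule P : submodule (below P).
Proof. exact/(@submodule_preimage _ _ _ val)/gen_span_submodule. Qed.

Lemma belowS P Q : P `<=` Q -> below P `<=` below Q.
Proof. by move=> /gen_spanS PQ x /PQ. Qed.

Lemma below_set0 x : below set0 x -> x = 0.
Proof. by move=> /gen_span_set0 x0; exact: val_inj. Qed.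

Definition tower_coords a (x : G) : 'I_(n a).+1 -> frac_mod iota :=
  coords_at a (val x).
Arguments tower_coords : clear implicits.

Fact tower_coords_is_linear a : linear (tower_coords a).
Proof. by []. Qed.

HB.instance Definition _ a := GRing.isLinear.Build R G
  ('I_(n a).+1 -> frac_mod iota) *:%R (tower_coords a)
  (tower_coords_is_linear a).

Lemma below_lt_ker a :
  below (lt^~ a) = below (le^~ a) `&` tower_coords a @^-1` [set 0].
Proof.
apply/seteqP; split=> [x ltx|x [lex x0]]; last exact: gen_span_le_lt.
by split; [apply: belowS ltx => v; right|exact: coords_at_lt_eq0].
Qed.

Lemma tower_coords_embedding a :
  exists2 psi : {linear Phi (label a) -> 'I_(n a).+1 -> frac_mod iota},
    injective psi & tower_coords a @` below (le^~ a) = range psi.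
Proof.
have [psi psiI psiE] := generating_frame_embedding (e_frame (label a))
  (e_generating (label a)) (coords_at_gen_frame a).
exists psi => //; apply/seteqP; split=> [_ [x ax <-]|_ [z _ <-]].
  have [u ltu] := gen_span_le_split ax; exists (lcomb (e (label a)) u) => //.
  rewrite psiE -linear_lcomb /tower_coords; apply/eqP.
  rewrite eq_sym -subr_eq0 -linearB.
  exact/eqP/coords_at_lt_eq0.
have [u _ <-] : range (lcomb (e (label a))) z by rewrite e_generating.
exists (in_tower (gen_span_lcomb gen u (Logic.I : setT a))).
  by apply: gen_span_lcomb; left.
by rewrite psiE -linear_lcomb.
Qed.

Lemma tower_quot a : quot_iso (below (le^~ a)) (below (lt^~ a)) (Phi (label a)).
Proof.
have [psi psiI im_psi] := tower_coords_embedding a.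
exact: quot_iso_linear psiI (below_submodule _) im_psi (below_lt_ker a).
Qed.

Lemma tower_represented : Phi_represented Phi G.
Proof.
pose lt_bound v bound := with_top lt (Some v) bound.
have top_wo := with_top_wo node_wo.
exists (option (node X)), (with_top lt).
exists (fun bound => below (lt_bound^~ bound)).
split; [exact: top_wo|split; [split|split; [|split]]].
- by move=> a; exact: below_submodule.
- by move=> a b ab; apply: belowS => v /(swo_trans top_wo); apply.
- move=> a amin x; split=> [|->]; last exact: submodule0 (below_submodule _).
  by move=> bx; apply: below_set0; apply: belowS bx => v /amin.
- move=> a [[b0|//] b0a] alim x; split=> [ax|[b [ba]]]; last first.
    by apply: belowS => v /(swo_trans top_wo); apply.
  have [c ca cx] := gen_span_max node_wo b0a ax.
  have [d [cd da]] : exists d, lt_bound c d /\ with_top lt d a.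
    apply: contrapT => nd; apply: alim; exists (Some c); split=> // d [cd da].
    by apply: nd; exists d.
  exists d; split=> //; apply: belowS cx => v vc.
  by case: d cd {da} => [d|//] cd; exact: (weak_lt_trans node_wo vc cd).
- by move=> x; exists None; apply: belowS (submod_valP x).
- move=> [a|] b //= ab nab; left; exists (label a).
  suff -> : lt_bound^~ b = le^~ a by exact: tower_quot.
  apply/seteqP; split=> v; last first.
    case: b ab {nab} => [b|//] ab va.
    exact: (weak_lt_trans node_wo va ab).
  move=> vb; have [//|av] := weak_or_lt node_wo v a.
  by exfalso; apply: (nab (Some v)).
Qed.

Lemma finite_rank_below P a0 (S : set G) k :
  down_closed P -> P a0 -> rank_at_most S k -> S `<=` below P ->
  exists2 a, P a & S `<=` below (le^~ a).
Proof.
move=> lP Pa0 rS SP; have [s [sS Ss]] := rank_at_most_span rS.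
have [|a Pa sa] :=
    gen_span_seq_max node_wo (gen := gen) (s := map val s) Pa0.
  by move=> _ /mapP[x /sS/SP Px ->].
exists a => // x /Ss[d d0 dx].
apply: (gen_span_down_closed_pure _ d0 (submod_valP x)).
  exact: down_closed_le.
rewrite -[_ *: _]/(val (d *: x)); apply: (span_in_min (below_submodule _)) dx.
by move=> y ys; apply: sa; exact: map_f.
Qed.

Lemma free_sub_below P k : down_closed P ->
  (forall a, P a -> forall S : set G, submodule S -> rank_at_most S k ->
     S `<=` below (le^~ a) -> free_sub S) ->
  forall S : set G, submodule S -> rank_at_most S k -> S `<=` below P ->
  free_sub S.
Proof.
move=> lP Pfree S sS rS SP; have [[a0 Pa0]|nP] := pselect (exists a, P a).
  by have [a Pa Sa] := finite_rank_below lP Pa0 rS SP; exact: Pfree Sa.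
apply: free_sub_set0 => x /SP Px; apply: below_set0; apply: belowS Px => v Pv.
by apply: nP; exists v.
Qed.

Lemma tower_free_sub k :
  (forall i (S : set (Phi i)), submodule S -> rank_at_most S k -> free_sub S) ->
  forall S : set G, submodule S -> rank_at_most S k -> free_sub S.
Proof.
move=> Phi_free S sS rS.
apply: (@free_sub_below setT k) => // [a _|x _]; last exact: submod_valP x.
elim/(well_founded_ind (swo_wf node_wo)): a {S sS rS} => a IH S sS rS Sa.
apply: (free_sub_extension (f := tower_coords a)) => //.
  apply: (free_sub_below (@down_closed_lt a) IH).
  - exact/submodule_setI/submodule_preimage/submodule_set0.
  - by apply: rank_at_mostS rS; exact: subIsetl.
  - by rewrite below_lt_ker => x [/Sa].
have [psi psiI im_psi] := tower_coords_embedding a.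
apply: (free_sub_preimage psiI).
  by rewrite -im_psi; exact: image_subset.
apply: Phi_free; first exact/submodule_preimage/submodule_image.
exact/(rank_at_most_preimage psiI)/rank_at_most_image.
Qed.

Lemma gen_span_delta (z : Z) : gspan setT (delta iota z).
Proof. by case: z => v j; rewrite -gen_init; exact: gen_span_gen. Qed.

Lemma tower_rank (K : Type) (f : K -> Z) : bijective f -> rank_is G K.
Proof.
move=> f_bij.
pose d (a : K) : G := in_tower (gen_span_delta (f a)).
apply: (@rank_is_torsion _ _ _ d).
- by move=> a b /(congr1 val)/(delta_inj)/(bij_inj f_bij).
- apply: (@independent_preimage _ _ _ val) => [? ? _ _|]; first exact: val_inj.
  apply: (independentS _ (independent_delta iota_inj (Z := Z))).
  by move=> _ [_ [a _ <-] <-]; exists (f a).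
have S_sub := submodule_image val (span_in_submodule (range d)).
move=> x.
have [c c0 [y dy yx]] : pure_closure (val @` span_in (range d)) (val x).
  have R_domain := frac_domain iota_inj.
  apply: (@gen_span_sub_pure setT) (submod_valP x) => //.
  - exact: pure_closure_submodule.
  - exact: pure_pure_closure.
  move=> v j _; apply: sub_pure_closure; have [g _ gK] := f_bij.
  pose a := g (existT _ v j); exists (d a); last by rewrite /= gK.
  by apply: sub_span_in; exists a.
exists c => //; rewrite (_ : c *: x = y) //.
by apply: val_inj; rewrite yx linearZ.
Qed.

End Tower.

(** * Trees and the cardinality of the construction *)

Lemma card_le_trans A B C : card_le A B -> card_le B C -> card_le A C.
Proof. by move=> [f fI] [g gI]; exists (g \o f); exact: inj_comp. Qed.

Lemma card_le_refl A : card_le A A.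
Proof. by exists id. Qed.

Lemma card_le_anti A B : card_le A B -> card_le B A -> card_eq A B.
Proof.
have card_leT (U W : Type) : card_le U W -> ([set: U] #<= [set: W])%card.
  move=> [f fI].
  have [|g] := (@injfunPex U W setT setT).2; last exact: inj_card_le g.
  by exists f => // u v _ _; exact: fI.
move=> /card_leT AB /card_leT BA.
have /card_bijP[f [g fK gK]] := Cantor_Bernstein AB BA.
pose toT U (u : U) : [set: U] := SigSub (mem_set (Logic.I : setT u)).
have toTK U (x : [set: U]) : toT U (val x) = x by exact: val_inj.
by exists (val \o f \o toT A), (val \o g \o toT B) => x;
  rewrite /= toTK ?fK ?gK.
Qed.

Lemma card_le_sigT_ord T (n : T -> nat) : card_le {t : T & 'I_(n t)} (T * nat).
Proof.
exists (fun z : {t : T & 'I_(n t)} => (tag z, nat_of_ord (tagged z))).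
move=> [t j] [t' j'] [/= tt'].
by case: _ / tt' j' => j' jj'; congr existT; exact: val_inj.
Qed.

Section CountablyClosedCardinal.
Variable K : Type.
Hypotheses (nat_K : card_le nat K) (seq_K : card_le (nat -> K) K).

Lemma card_le_countable (C : countType) : card_le C K.
Proof.
by apply: card_le_trans nat_K; exists pickle; exact: pcan_inj pickleK.
Qed.

Lemma card_le_arrow (C : countType) A : card_le A K -> card_le (C -> A) K.
Proof.
move=> [f fI]; have [i _] := nat_K; apply: card_le_trans seq_K.
exists (fun g m => if unpickle m is Some c then f (g c) else i 0%N) => g h gh.
apply/funext => c; apply: fI.
by have := congr1 (fun u : nat -> K => u (pickle c)) gh; rewrite pickleK.
Qed.

Lemma card_le_prod A B : card_le A K -> card_le B K -> card_le (A * B) K.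
Proof.
move=> [f fI] [g gI]; have [h hI] := card_le_arrow bool (card_le_refl K).
exists (fun x => h (fun b : bool => if b then f x.1 else g x.2)).
move=> [a b] [a' b'] /hI e.
congr (_, _); first by apply: fI; exact: (congr1 (@^~ true) e).
by apply: gI; exact: (congr1 (@^~ false) e).
Qed.

Lemma card_le_sum A B : card_le A K -> card_le B K -> card_le (A + B) K.
Proof.
move=> [f fI] [g gI].
have [h hI] := card_le_prod (card_le_countable bool) (card_le_refl K).
exists (fun x =>
  h match x with inl a => (true, f a) | inr b => (false, g b) end).
by move=> [a|b] [a'|b'] /hI[] // => [/fI ->|/gI ->].
Qed.

Lemma card_le_seq A : card_le A K -> card_le (seq A) K.
Proof.
move=> AK.
have [h hI] := card_le_arrow nat (card_le_sum (card_le_countable unit) AK).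
exists (fun s => h (fun j => if onth s j is Some a then inr a else inl tt)).
move=> s t /hI st.
apply: eq_from_onth => j; have := congr1 (@^~ j) st => /=.
by case: (onth s j) (onth t j) => [a|] [b|] // [->].
Qed.

End CountablyClosedCardinal.

Inductive tree (A B C : Type) : Type :=
| Leaf of A
| Node of B & (C -> tree A B C).

HB.instance Definition _ A B C := gen_eqMixin (tree A B C).

Section Tree.
Variables A B C : Type.
Implicit Types t u : tree A B C.

Definition child t u : Prop :=
  if u is Node _ h then exists c, t = h c else False.

Lemma child_wf : well_founded child.
Proof.
by elim=> [a|b h IH]; constructor=> t; [case|case=> c ->; exact: IH].
Qed.

Fixpoint label_at t (path : seq C) : A + B :=
  match t, path with
  | Node _ h, c :: path' => label_at (h c) path'
  | Node b _, [::] => inr b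
  | Leaf a, _ => inl a
  end.

Lemma label_at_inj : injective label_at.
Proof.
elim=> [a|b h IH] [a'|b' h'] e.
- by have [->] := congr1 (@^~ [::]) e.
- by have := congr1 (@^~ [::]) e.
- by have := congr1 (@^~ [::]) e.
have [->] := congr1 (@^~ [::]) e; congr Node; apply/funext => c.
by apply: IH; apply/funext => path; exact: (congr1 (@^~ (c :: path)) e).
Qed.

End Tree.

Lemma card_le_tree K A B (C : countType) :
  card_le nat K -> card_le (nat -> K) K -> card_le A K -> card_le B K ->
  card_le (tree A B C) K.
Proof.
move=> nat_K seq_K AK BK.
have := card_le_arrow nat_K seq_K (seq C) (card_le_sum nat_K seq_K AK BK).
by apply: card_le_trans; exists (@label_at A B C); exact: label_at_inj.
Qed.

Section TreeNodes.
Variables (R : comNzRingType) (F : fieldType) (iota : {rmorphism R -> F}).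
Hypothesis iota_inj : injective iota.
Variables (I K : Type) (D : I -> relation_system R) (i0 : I) (a0 : K).

(* [Node (i, s) h] requests a solution of the relations of [D i] whose [m]-th
   error is [\sum_q r * g], where [(r, j)] is the [q]-th term of [s m] and [g]
   is the [j]-th generator of the node [h (m, q)]. The leaves carry copies of
   [D i0], which make the rank at least the cardinality of [K]. *)
Local Notation T := (tree K (I * (nat -> seq (R * nat))) (nat * nat)).
Implicit Type t : T.

Definition tree_label t : I := if t is Node (i, _) _ then i else i0.

Local Notation V := (coordinate D tree_label -> frac_mod iota).

Definition term_sum (s : seq (R * nat)) (g : nat -> nat -> V) : V :=
  \sum_(q < size s) let: (r, j) := nth (0, 0%N) s q in r *: g q j.

Fixpoint tree_gen t : nat -> V :=
  solve (D := D (tree_label t)) (fun j => delta iota (existT _ t j)) (fun m =>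
    if t is Node (_, s) h then term_sum (s m) (fun q => tree_gen (h (m, q)))
    else 0).

Definition request t m : V :=
  if t is Node (_, s) h then term_sum (s m) (fun q => tree_gen (h (m, q)))
  else 0.

Lemma tree_gen_init t (j : 'I_(nfree (D (tree_label t))).+1) :
  tree_gen t j = delta iota (existT _ t j).
Proof. by case: t j => [a|b h] j; exact: solve_init. Qed.

Lemma tree_gen_solution t :
  solution (D (tree_label t)) (tree_gen t) (request t).
Proof. by case: t => [a|b h]; exact: solve_solution. Qed.

Lemma request_below (lt : T -> T -> Prop) t m :
  (forall c b, child c b -> lt c b) -> gen_span tree_gen (lt^~ t) (request t m).
Proof.
move=> child_lt; have sp := gen_span_submodule tree_gen (lt^~ t).
case: t sp => [a|[i s] h] sp; first exact: submodule0.
apply: (submodule_sum sp) => q _; case: nth => r j; apply: (submoduleZ sp).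
have ht : lt (h (m, val q)) (Node (i, s) h).
  by apply: child_lt; exists (m, val q).
exact: gen_span_gen.
Qed.

Lemma gen_span_term_sum w : gen_span tree_gen setT w ->
  exists (s : seq (R * nat)) (h : nat -> T),
    w = term_sum s (fun q => tree_gen (h q)).
Proof.
move=> /span_inP[s [sP ->]].
pose gens := [set tree_gen t j | t in setT & j in setT].
have /choice[g gP] : forall y : V, exists tj : T * nat,
    gens y -> tree_gen tj.1 tj.2 = y.
  move=> y; have [[t _ [j _ <-]]|ny] := pselect (gens y).
    by exists (t, j).
  by exists (Leaf _ _ a0, 0%N).
exists [seq (z.1, (g z.2).2) | z <- s], (fun q => (g (nth (0, 0) s q).2).1).
rewrite /term_sum (big_nth (0, 0)) big_mkord size_map; apply: eq_bigr => q _.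
by rewrite (nth_map (0, 0)) //= gP //; apply/sP/mem_nth.
Qed.

Lemma request_onto i (z : nat -> V) :
  (forall m, gen_span tree_gen setT (z m)) ->
  exists t, solution (D i) (tree_gen t) z.
Proof.
move=> /(_ _)/gen_span_term_sum zP; have /choice[s /choice[h hP]] := zP.
exists (Node (i, s) (fun mq => h mq.1 mq.2)) => m.
by rewrite (tree_gen_solution (Node (i, s) _)) [RHS]hP.
Qed.

Lemma exists_node_system :
  card_le I K -> card_le R K -> card_le nat K -> card_le (nat -> K) K ->
  exists X : node_system iota D, card_eq K (node_coordinate X).
Proof.
move=> IK RK nat_K seq_K.
have [lt lt_wo child_lt] :=
  @extend_well_founded T (@child _ _ _) (@child_wf _ _ _).
have below t m : gen_span tree_gen (lt^~ t)
    (lcomb (tree_gen t) (relator (D (tree_label t)) m)).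
  by rewrite tree_gen_solution; exact: request_below.
exists (NodeSystem lt_wo tree_gen_init below request_onto); apply: card_le_anti.
  exists (fun a => existT _ (Leaf _ _ a) ord0) => a b e.
  by case: (congr1 tag e).
apply: card_le_trans (card_le_sigT_ord _) _; apply: card_le_prod => //.
apply: card_le_tree => //; first exact: card_le_refl.
apply: card_le_prod => //; apply: card_le_arrow => //; apply: card_le_seq => //.
exact: card_le_prod.
Qed.

End TreeNodes.

Lemma rat_fraction (R : comNzRingType) (iota : {rmorphism R -> rat}) :
  injective iota ->
  forall q : rat, exists2 d : R, d != 0 & exists c, iota c = iota d * q.
Proof.
move=> iota_inj q; exists (denq q)%:~R.
  by rewrite -(iota_eq0 iota_inj) rmorph_int intr_eq0 denq_neq0.
by exists (numq q)%:~R; rewrite !rmorph_int numqE mulrC.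
Qed.

Lemma finite_rank_free_by_1_frame (R : comNzRingType) (M : lmodType R) :
  finite_rank_free_by_1 M -> exists De : relation_system R * (nat -> M),
  [/\ frame De.1 De.2, generating De.2 &
    forall S : set M, submodule S -> rank_at_most S (nfree De.1) -> free_sub S].
Proof.
move=> [n [/presented_by_frame[D [e [<- De ge]]] _ Mfree]].
by exists (D, e); split=> //; exact: Mfree.
Qed.

Theorem theorem4p8
  (R : comNzRingType) (iota : {rmorphism R -> rat})
  (iota_inj : injective iota) (iota_proper : exists q : rat, forall r : R, iota r != q)
  (I : Type) (Phi : I -> lmodType R) (I_ne : inhabited I)
  (HPhi : forall i, finite_rank_free_by_1 (Phi i))
  (K : Type) (HKreg : infinite_regular K) (HKw : card_eq (nat -> K) K)
  (HIK : card_lt I K) :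
  exists G : lmodType R,
    [/\ torsion_free G, Phi_complete Phi G, Phi_represented Phi G, rank_is G K &
        forall n : nat, (forall i, rank_at_least (Phi i) n.+1) ->
          forall S : G -> Prop, submodule S -> rank_at_most S n -> free_sub S].
Proof.
have [i0] := I_ne; have [nat_K _] := HKreg; have [IK _] := HIK.
have seq_K : card_le (nat -> K) K by have [f /bij_inj] := HKw; exists f.
have R_K : card_le R K.
  by apply: card_le_trans (card_le_countable nat_K rat); exists iota.
pose De i := cid (finite_rank_free_by_1_frame (HPhi i)).
pose D i := (projT1 (De i)).1; pose e i : nat -> Phi i := (projT1 (De i)).2.
have fe i : frame (D i) (e i) by case: (projT2 (De i)).
have ge i : generating (e i) by case: (projT2 (De i)).
have [a0 _] := nat_K.
have [X [f f_bij]] :=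
  exists_node_system iota_inj D i0 (a0 0%N) IK R_K nat_K seq_K.
exists (tower X); split.
- exact: tower_torsion_free.
- exact: tower_complete.
- exact: (tower_represented _ fe ge).
- exact: (tower_rank _ f_bij).
move=> n rank_Phi; apply: (tower_free_sub iota_inj fe ge) => i S sS rS.
have [_ _ Phi_free] := projT2 (De i); apply: Phi_free => // s us sub_s ind_s.
apply: leq_trans (rS s us sub_s ind_s) _; rewrite -ltnS.
exact: (frame_rank_at_least iota_inj (rat_fraction iota_inj) (fe i) (ge i)).
Qed.
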